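(* Let $\mathcal A$ be a countable abelian group with a coloring map $\theta$ and $\Gamma$ a countable abelian semigroup such that every element of $\Gamma\times\mathcal A$ can be written as a sum of elements of $\Gamma\times\mathcal A$ in only finitely many ways. Let $V=\bigoplus_{(\alpha,a)\in\Gamma\times\mathcal A}V_{(\alpha,a)}$ be a $(\Gamma\times\mathcal A)$-graded superspace over $\mathbb C$ with finite-dimensional homogeneous subspaces. Let $L=\bigoplus L_{(\alpha,a)}$ be the free Lie algebra generated by $V$ (ignoring $\theta$), and let $\mathfrak L=\bigoplus\mathfrak L_{(\alpha,a)}$ be the free ($\theta$-colored) Lie superalgebra generated by $V$. Suppose that a group $G$ acts on $V$ preserving the $(\Gamma\times\mathcal A)$-gradation. Then for every $g\in G$ and $(\alpha,a)\in\Gamma\times\mathcal A$, $$\mathrm{str}(g|\mathfrak L_{(\alpha,a)})=\psi(a)\,\mathrm{tr}(g|L_{(\alpha,a)})+\sum_{\substack{(\beta,b)\in\Gamma\times\mathcal A_1\\2(\beta,b)=(\alpha,a)}}\mathrm{tr}(g^2|L_{(\beta,b)}).$$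
   Context: A coloring map is $\theta:\mathcal A\times\mathcal A\to\mathbb C^\times$, bimultiplicative, with $\theta(a,b)\theta(b,a)=1$; $\psi(a)=\theta(a,a)=\pm1$, and $\mathcal A_1=\{a\in\mathcal A:\psi(a)=-1\}$ is the set of odd elements. A $\theta$-colored $(\Gamma\times\mathcal A)$-graded Lie superalgebra is a graded space with bracket additive on degrees, $[x,y]=-\theta(a,b)[y,x]$, $[x,[y,z]]=[[x,y],z]+\theta(a,b)[y,[x,z]]$ for $x,y$ homogeneous of $\mathcal A$-degrees $a,b$. Both $L$ and $\mathfrak L$ carry the $(\Gamma\times\mathcal A)$-gradation induced from $V$, and the action of $G$ on $V$ extends to $L$ by Lie algebra automorphisms and to $\mathfrak L$ by Lie superalgebra automorphisms. $\mathrm{str}(g|\mathfrak L_{(\alpha,a)})=\psi(a)\,\mathrm{tr}(g|\mathfrak L_{(\alpha,a)})$. *)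

(* Defs.v *)
From HB Require Import structures.
From mathcomp Require Import all_boot all_order all_algebra.
From mathcomp Require Import complex.
From mathcomp Require Import all_classical all_reals.

Set Implicit Arguments.
Unset Strict Implicit.
Unset Printing Implicit Defensive.

Import GRing.Theory.
Local Open Scope classical_set_scope.
Local Open Scope ring_scope.

(* Ordered sums of arbitrary positive length. A semigroup need not have a zero,
   so a nonempty family is encoded as a last term s.1 preceded by the list s.2.
   Counting ordered or unordered sums gives the same finiteness condition. *)
Definition sum_nonempty (I : addSemigroupType) (s : I * seq I) : I :=
  foldr (fun p q => p + q) s.1 s.2.

Definition finitely_many_sums (I : addSemigroupType) : Prop :=
  forall p : I, finite_set [set s | sum_nonempty s = p].

Section LinearAlgebra.
Variable K : fieldType.
Implicit Types V : lmodType K.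

Record grading (I : choiceType) V (gr : I -> set V) : Prop := Grading {
  grading_subspace : forall p, submod_closed [in gr p];
  grading_span : forall v, exists (s : seq I) (w : I -> V),
    (forall p, gr p (w p)) /\ v = \sum_(p <- s) w p;
  grading_free : forall (s : seq I) (w : I -> V), uniq s ->
    (forall p, gr p (w p)) -> \sum_(p <- s) w p = 0 ->
    forall p, p \in s -> w p = 0 }.

Definition is_basis V (W : set V) (n : nat) (b : 'I_n -> V) : Prop :=
  W = [set v | exists c : 'I_n -> K, v = \sum_i c i *: b i] /\
  forall c : 'I_n -> K, \sum_i c i *: b i = 0 -> forall i, c i = 0.

Definition finite_dim V (W : set V) : Prop :=
  exists (n : nat) (b : 'I_n -> V), is_basis W b.

(* tr(f | W): the trace of a matrix of f in a basis of W. The value does not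
   depend on the basis, and it is 0 by convention when W is not
   finite-dimensional or not stable under f. *)
Definition trace_on V (f : V -> V) (W : set V) : K :=
  xget 0 [set t | exists (n : nat) (b : 'I_n -> V) (M : 'M[K]_n),
    [/\ is_basis W b,
        forall j, f (b j) = \sum_i M i j *: b i
      & t = \tr M]].

Record linear_action (G : groupType) V (rho : G -> V -> V) : Prop :=
  LinearAction {
    action_linear : forall g, linear (rho g);
    action1 : forall v, rho 1%g v = v;
    actionM : forall g h v, rho (g * h)%g v = rho g (rho h v) }.

End LinearAlgebra.

Section Lie.
Variable K : fieldType.

Record lie_bracket (L : lmodType K) (br : L -> L -> L) : Prop := LieBracket {
  lie_linearl : forall y, linear (br^~ y);
  lie_linearr : forall x, linear (br x);
  lie_alt : forall x, br x x = 0;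
  lie_jacobi : forall x y z, br x (br y z) = br (br x y) z + br y (br x z) }.

Definition bracket_hom (L M : lmodType K) (brL : L -> L -> L)
    (brM : M -> M -> M) (F : L -> M) : Prop :=
  linear F /\ forall x y, F (brL x y) = brM (F x) (F y).

Definition free_lie (V L : lmodType K) (brL : L -> L -> L) (iota : V -> L) :
    Prop :=
  [/\ lie_bracket brL, linear iota &
      forall (M : lmodType K) (brM : M -> M -> M) (f : V -> M),
        lie_bracket brM -> linear f ->
        exists! F : L -> M,
          bracket_hom brL brM F /\ forall v, F (iota v) = f v].

Definition graded_bracket (I : addSemigroupType) (L : lmodType K)
    (gr : I -> set L) (br : L -> L -> L) : Prop :=
  forall p q x y, gr p x -> gr q y -> gr (p + q) (br x y).

Definition degree_preserving (I : Type) (V W : lmodType K)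
    (grV : I -> set V) (grW : I -> set W) (f : V -> W) : Prop :=
  forall p x, grV p x -> grW p (f x).

(* As L is generated by iota(V), these conditions determine grL: the component
   of degree p is spanned by the iterated brackets of homogeneous elements of V
   whose degrees add up to p. *)
Definition induced_grading (I : addSemigroupType) (V L : lmodType K)
    (grV : I -> set V) (brL : L -> L -> L) (iota : V -> L)
    (grL : I -> set L) : Prop :=
  [/\ grading grL, graded_bracket grL brL & degree_preserving grV grL iota].

Section Color.
Variables (A : zmodType) (theta : A -> A -> K).

Record coloring_map : Prop := ColoringMap {
  coloring_neq0 : forall a b, theta a b != 0;
  coloringDl : forall a b c, theta (a + b) c = theta a c * theta b c;
  coloringDr : forall a b c, theta a (b + c) = theta a b * theta a c;
  coloringC : forall a b, theta a b * theta b a = 1 }.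

Definition psi (a : A) : K := theta a a.

Definition odd_elements : set A := [set a | psi a = -1].

Variable Gam : addSemigroupType.

Record color_lie_superalgebra (L : lmodType K) (gr : Gam * A -> set L)
    (br : L -> L -> L) : Prop := ColorLieSuperalgebra {
  color_grading : grading gr;
  color_linearl : forall y, linear (br^~ y);
  color_linearr : forall x, linear (br x);
  color_graded : graded_bracket gr br;
  color_antisym : forall al a be b x y, gr (al, a) x -> gr (be, b) y ->
    br x y = - (theta a b *: br y x);
  color_jacobi : forall al a be b x y z, gr (al, a) x -> gr (be, b) y ->
    br x (br y z) = br (br x y) z + theta a b *: br y (br x z) }.

(* Freeness among (Gam * A)-graded theta-colored Lie superalgebras and
   degree-preserving homomorphisms; the grading grL induced from V is part of
   the free object. *)
Definition free_color_lie (V L : lmodType K) (grV : Gam * A -> set V)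
    (grL : Gam * A -> set L) (brL : L -> L -> L) (iota : V -> L) : Prop :=
  [/\ color_lie_superalgebra grL brL,
      linear iota,
      degree_preserving grV grL iota &
      forall (M : lmodType K) (grM : Gam * A -> set M) (brM : M -> M -> M)
        (f : V -> M),
        color_lie_superalgebra grM brM -> linear f ->
        degree_preserving grV grM f ->
        exists! F : L -> M,
          [/\ bracket_hom brL brM F, degree_preserving grL grM F &
              forall v, F (iota v) = f v]].

Definition supertrace_on (V : lmodType K) (f : V -> V)
    (gr : Gam * A -> set V) (p : Gam * A) : K :=
  psi p.2 * trace_on f (gr p).

End Color.

Definition extends_action (G : groupType) (V L : lmodType K) (iota : V -> L)
    (rho : G -> V -> V) (rhoL : G -> L -> L) : Prop :=
  forall g v, rhoL g (iota v) = iota (rho g v).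

End Lie.

(* Main.v *)
(* Both sides depend on g only through a triangularization: choose a homogeneous
   basis X of V in which g is triangular. Then g is triangular on iterated
   brackets of letters, with eigenvalues multiplicative in the content, so each
   trace is a sum of eigenvalues over a homogeneous basis.
   Such bases come from Lazard elimination. Removing one letter x writes a free
   color Lie superalgebra as the sum of the line of x, of the line of [x, x] if x
   is odd, and of the free algebra on the letters ad(x)^n z with z <> x. In a
   fixed degree this terminates, because the number of words of that degree
   drops. The degrees of the eliminated letters do not depend on the coloring,
   and the trivial coloring gives the free Lie algebra. Hence the two bases differ
   exactly by the squares of odd elements, and a square of an element with
   eigenvalue l contributes l^2, an eigenvalue of g^2.
   Elimination shows that the brackets span; they are independent because the
   leading word of ad(x)^n z in the free associative algebra is x^n z. *)

Require Import Defs.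
From HB Require Import structures.
From mathcomp Require Import all_boot all_order all_algebra.
From mathcomp Require Import complex spectral zify ring.
From mathcomp Require finmap.
From mathcomp.multinomials Require Import monalg.
From mathcomp Require Import all_classical all_reals.

Set Implicit Arguments.
Unset Strict Implicit.
Unset Printing Implicit Defensive.

Import GRing.Theory.
Local Open Scope classical_set_scope.
Local Open Scope ring_scope.

(** * Free associative algebras *)

(** Both algebras are given only by universal properties, so no basis can be read off a
    construction. That the letters generate comes from mapping the algebra to its own generated
    subalgebra: by uniqueness, the composite with the inclusion is the identity. Independence comes
    from mapping it to a free associative algebra equipped with a color commutator, where leading
    words can be compared. The elimination runs over a commutative monoid of degrees that store the
    index, the eigenvalue and the flag position of a word together. Its list of degrees is fixed
    before the coloring and the algebra are quantified, so a single list yields the traces of [g]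
    and of its square on both sides, in degree [(al, a)] and in all halves of that degree. The
    comparison is then an identity between sums over this list. Characteristic zero enters through
    the image 2xx of [x, x] for odd x, through 3[x, [x, x]] = 0, and through 1 differing from -1. *)

Definition word (X : Type) := seq X.

HB.instance Definition _ (X : choiceType) := Choice.on (word X).

Lemma word_cat_nil (X : choiceType) (u v : word X) :
  u ++ v = [::] -> u = [::] /\ v = [::].
Proof. by case: u => //; case: v. Qed.

HB.instance Definition _ (X : choiceType) :=
  Choice_isMonomialDef.Build (word X) (@catA X) (@cat0s X) (@cats0 X)
    (@word_cat_nil X).

Lemma malg_scalerAr (K : comNzRingType) (M : monomType) (c : K)
  (p q : {malg K[M]}) : c *: (p * q) = p * (c *: q).
Proof.
apply/malgP => k; have lepp := finmap.fsubset_refl (msupp p).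
rewrite mcoeffZ (mcoeffMlw _ lepp (finmap.fsubset_refl (msupp q))).
rewrite (mcoeffMlw _ lepp (msuppZ_le c q)) mulr_sumr.
apply: eq_bigr => k1 _; rewrite mulr_sumr; apply: eq_bigr => k2 _.
by rewrite mcoeffZ mulrnAr [p@_k1 * (c * _)]mulrCA.
Qed.

Definition free_alg (K : fieldType) (X : choiceType) : Type :=
  {malg K[word X]}.

HB.instance Definition _ (K : fieldType) (X : choiceType) :=
  GRing.Lalgebra.copy (free_alg K X) {malg K[word X]}.

HB.instance Definition _ (K : fieldType) (X : choiceType) :=
  GRing.Lalgebra_isAlgebra.Build K (free_alg K X)
    (@malg_scalerAr K (word X)).

Section Evaluation.
Variables (K : fieldType) (Y : choiceType) (B : algType K).
Implicit Types (f : Y -> B) (p q : free_alg K Y).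

Definition evalw f (w : word Y) : B := \prod_(i <- w) f i.

Definition eval f p : B := mmap (in_alg B) (evalw f) p.

Lemma evalw_cat f u v : evalw f (u ++ v) = evalw f u * evalw f v.
Proof. exact: big_cat. Qed.

Lemma eval_word f c w : eval f << c *g w >> = c *: evalw f w.
Proof. by rewrite /eval mmapU /= mulr_algl. Qed.

Lemma evalD f p q : eval f (p + q) = eval f p + eval f q.
Proof. exact: raddfD. Qed.

Lemma eval0 f : eval f 0 = 0.
Proof. exact: raddf0. Qed.

Lemma evalZ f c p : eval f (c *: p) = c *: eval f p.
Proof.
rewrite /eval (mmapEw (msuppZ_le c p)) mmapE scaler_sumr.
by apply: eq_bigr => w _; rewrite mcoeffZ /= !mulr_algl scalerA.
Qed.

Lemma eval_sum (I : Type) (s : seq I) f (h : I -> free_alg K Y) :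
  eval f (\sum_(i <- s) h i) = \sum_(i <- s) eval f (h i).
Proof. exact: raddf_sum. Qed.

Lemma eval1 f : eval f 1 = 1.
Proof.
have -> : 1 = << [::] >> :> free_alg K Y by [].
by rewrite eval_word scale1r /evalw big_nil.
Qed.

Lemma evalB f p q : eval f (p - q) = eval f p - eval f q.
Proof. exact: raddfB. Qed.

Lemma evalM f p q : eval f (p * q) = eval f p * eval f q.
Proof.
rewrite malgME [p in RHS]monalgE [q in RHS]monalgE !eval_sum mulr_suml.
apply: eq_bigr => u _; rewrite eval_sum mulr_sumr; apply: eq_bigr => v _.
by rewrite !eval_word evalw_cat -scalerAl -scalerAr scalerA.
Qed.

Lemma eval_ext f f' p : f =1 f' -> eval f p = eval f' p.
Proof. by move=> /funext ->. Qed.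

End Evaluation.

Lemma eval_comp (K : fieldType) (Y Z : choiceType) (B : algType K)
  (f : Z -> B) (q : Y -> free_alg K Z) (p : free_alg K Y) :
  eval (fun i => eval f (q i)) p = eval f (eval q p).
Proof.
rewrite [p]monalgE [eval q _]eval_sum !eval_sum; apply: eq_bigr => w _.
rewrite !eval_word evalZ; congr (_ *: _).
rewrite /evalw; elim: w => [|i w IH].
  by rewrite !big_nil eval1.
by rewrite !big_cons evalM IH.
Qed.

(** * Elimination of a letter in the free associative algebra *)

Definition letter (K : fieldType) (X : choiceType) (i : X) : free_alg K X :=
  << ([:: i] : word X) >>.
Arguments letter {K X}.

Section Support.
Variables (K : fieldType) (Y : choiceType).
Implicit Types (p q : free_alg K Y) (P Q : word Y -> Prop) (u v w : word Y).

Definition supported P p := forall w, p@_w != 0 -> P w.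

Lemma sub_supported P Q p :
  (forall w, P w -> Q w) -> supported P p -> supported Q p.
Proof. by move=> PQ Pp w /Pp/PQ. Qed.

Lemma supported0 P : supported P 0.
Proof. by move=> w; rewrite mcoeff0 eqxx. Qed.

Lemma supported_word P w : P w -> supported P (<< w >> : free_alg K Y).
Proof.
by move=> Pw v; rewrite mcoeffU1; case: (eqVneq w v) => [<-|]; rewrite ?eqxx.
Qed.

Lemma supportedD P p q : supported P p -> supported P q -> supported P (p + q).
Proof.
move=> Pp Pq w; rewrite mcoeffD => pq; have [p0|/Pp //] := eqVneq (p@_w) 0.
by apply: Pq; move: pq; rewrite p0 add0r.
Qed.

Lemma supportedZ P c p : supported P p -> supported P (c *: p).
Proof.
by move=> Pp w; rewrite mcoeffZ mulf_eq0 negb_or => /andP[_ /Pp].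
Qed.

Lemma supportedB P p q : supported P p -> supported P q -> supported P (p - q).
Proof.
by move=> Pp Pq; apply: supportedD => //; rewrite -scaleN1r; apply: supportedZ.
Qed.

Lemma supportedM P Q (R : word Y -> Prop) p q :
  (forall u v, P u -> Q v -> R (u ++ v)) ->
  supported P p -> supported Q q -> supported R (p * q).
Proof.
move=> PQR Pp Qq w; rewrite mcoeff_neq0 => /msuppM_le [u [v [Hu Hv ->]]].
by apply: PQR; [apply: Pp|apply: Qq]; rewrite mcoeff_neq0.
Qed.

End Support.

Lemma seq_arg_max (T : eqType) (s : seq T) (f : T -> nat) : s != [::] ->
  exists2 t, t \in s & forall t', t' \in s -> (f t' <= f t)%N.
Proof.
elim: s => // a [|b s] IH _; first by exists a => [|t]; rewrite inE // => /eqP ->.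
have [//|t ts tmax] := IH; have [le|lt] := leqP (f a) (f t).
  exists t; first by rewrite inE ts orbT.
  by move=> t'; rewrite inE => /orP[/eqP -> //|/tmax].
exists a; first by rewrite inE eqxx.
move=> t'; rewrite inE => /orP[/eqP -> //|/tmax /leq_trans]; apply; exact: ltnW.
Qed.

Section Elimination.
Variables (K : fieldType) (Y : choiceType) (x : Y).

Notation Y' := (nat * {z : Y | z != x})%type.

(** The word x^n z, which is the leading word of the new letter ad(x)^n z. *)
Definition letter_word (i : Y') : word Y := rcons (nseq i.1 x) (val i.2).

Definition expand (w : word Y') : word Y := flatten [seq letter_word i | i <- w].

(** The words x^n z form a prefix code: each block ends at the first letter other than x. *)
Lemma expand_inj : injective expand.
Proof.
elim=> [|[n z] w IH] [|[m z'] w'] //=.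
- by rewrite /expand /letter_word /=; case: m.
- by rewrite /expand /letter_word /=; case: n.
rewrite /expand /= /letter_word /= -!/(expand _) !cat_rcons => E.
suff [-> -> /IH -> //] : [/\ n = m, z = z' & expand w = expand w'].
elim: n m E => [|n IHn] [|m] /= [].
- by move=> /val_inj -> ->.
- by move=> E; move: (valP z); rewrite /= E eqxx.
- by move=> E; move: (valP z'); rewrite /= -E eqxx.
- by move=> /IHn [-> -> ->].
Qed.

Lemma expand_cat u v : expand (u ++ v) = expand u ++ expand v.
Proof. by rewrite /expand map_cat flatten_cat. Qed.

(** This makes the elimination terminate: an old word ending in x is never the expansion of a new
    word. *)
Lemma expand_rcons_neq w v : expand w <> rcons v x.
Proof.
elim/last_ind: w => [|w i _]; first by case: v.
rewrite -cats1 expand_cat /expand /= cats0 /letter_word -rcons_cat => /rcons_inj[_ E].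
by move: (valP i.2); rewrite /= E eqxx.
Qed.

(* The word read as a binary number, the letter x being the digit 1: this ranks
   words of the same length lexicographically, x being the largest letter. *)
Definition rank (w : word Y) : nat := foldl (fun a i => a.*2 + (i == x))%N 0%N w.

Lemma rank_cat u v : rank (u ++ v) = (rank u * 2 ^ size v + rank v)%N.
Proof.
rewrite /rank foldl_cat; move: (foldl _ 0%N u) => a.
elim/last_ind: v => [|v i IH] /=; first by rewrite expn0 muln1 addn0.
by rewrite !foldl_rcons IH size_rcons expnS mulnCA -!mul2n mulnDr addnA.
Qed.

(** In binary x^n z reads 1...10, that is 2^(n+1) - 2; adding 2 on the left avoids truncated
    subtraction. *)
Lemma rank_letter i : (rank (letter_word i)).+2 = (2 ^ i.1.+1)%N.
Proof.
case: i => n z; rewrite /letter_word -cats1 rank_cat /= [rank [:: _]]/rank /=.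
rewrite (negPf (valP z)) addn0; elim: n => //= n IH.
rewrite -[x :: _]cat1s rank_cat size_nseq [rank [:: x]]/rank /= eqxx.
by move: IH; rewrite expn1 !expnS; lia.
Qed.

Definition below n r (w : word Y) : Prop := size w = n /\ (rank w < r)%N.

(** Since [rank] only sees which letters are x, distinct words may tie. The condition therefore asks
    for coefficient 1 at [w] and strictly smaller rank for every other word of [p]. *)
Definition leading (w : word Y) (p : free_alg K Y) : Prop :=
  supported (below (size w) (rank w)) (p - << w >>).

Lemma leading_word w : leading w << w >>.
Proof. by rewrite /leading subrr; apply: supported0. Qed.

Lemma leading_supported w p :
  leading w p -> supported (below (size w) (rank w).+1) p.
Proof.
move=> lp; rewrite -[p](subrK << w >>); apply: supportedD.
  by apply: sub_supported lp => v [? /ltnW]; split.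
by apply: supported_word; split.
Qed.

Lemma leadingM u v p q : leading u p -> leading v q -> leading (u ++ v) (p * q).
Proof.
move=> lp lq; rewrite /leading.
have -> : << u ++ v >> = << u >> * << v >> :> free_alg K Y.
  by rewrite malgM_def fgmulUU mulr1.
have -> : p * q - << u >> * << v >> =
    (p - << u >>) * q + << u >> * (q - << v >>).
  by rewrite mulrBl mulrBr addrA subrK.
apply: supportedD.
  apply: supportedM lp (leading_supported lq) => a b [sa ra] [sb rb].
  split; first by rewrite !size_cat sa sb.
  by rewrite !rank_cat sb; nia.
have lu : supported (eq^~ u) (<< u >> : free_alg K Y) by apply: supported_word.
apply: supportedM lu lq => _ b -> [sb rb].
split; first by rewrite !size_cat sb.
by rewrite !rank_cat sb; nia.
Qed.

Section AdPolynomials.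
(* c n z stands for the commutation factor of x and ad(x)^n z. *)
Variable c : nat -> {z : Y | z != x} -> K.

Fixpoint adpoly_rec n (z : {z : Y | z != x}) : free_alg K Y :=
  if n is m.+1 then
    letter x * adpoly_rec m z - c m z *: (adpoly_rec m z * letter x)
  else letter (val z).

Definition adpoly (i : Y') := adpoly_rec i.1 i.2.

Lemma leading_adpoly i : leading (letter_word i) (adpoly i).
Proof.
case: i => n z; rewrite /adpoly /=.
elim: n => [|n IH] /=; first exact: leading_word.
rewrite /leading addrAC; apply: supportedB.
  exact: (leadingM (@leading_word [:: x]) IH).
(* The words of the subtracted product have rank at most 2(2^(n+1) - 2) + 1 = 2^(n+2) - 3, just
   below the rank 2^(n+2) - 2 of x^(n+1) z. *)
apply: supportedZ; have lx := leading_supported (@leading_word [:: x]).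
apply: supportedM (leading_supported IH) lx => a b [sa ra] [sb rb].
split; first by rewrite size_cat sa sb addn1.
have := rank_letter (n, z); rewrite rank_cat sb /= => rE.
rewrite -[letter_word (n.+1, z)]/([:: x] ++ letter_word (n, z)) rank_cat.
have -> : size (letter_word (n, z)) = n.+1 by rewrite size_rcons size_nseq.
move: ra rb; rewrite [rank [:: x]]/rank /= eqxx -rE; lia.
Qed.

Lemma leading_evalw w : leading (expand w) (evalw adpoly w).
Proof.
elim: w => [|i w IH]; first by rewrite /evalw big_nil; apply: leading_word.
rewrite /evalw big_cons; exact: leadingM (@leading_adpoly i) IH.
Qed.

(** The elements ad(x)^n z generate a free associative subalgebra, whatever the factors [c], because
    their products have distinct leading words. *)
Lemma eval_adpoly_inj p : eval adpoly p = 0 -> p = 0.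
Proof.
move=> Ep; apply/eqP/negPn/negP => p_neq0.
have : finmap.enum_fset (msupp p) != [::].
  by apply: contraNneq p_neq0 => E; rewrite [p]monalgE E big_nil.
(* At the word [expand w] only the term of [w] contributes. Another [v] of the support has a
   different leading word, and its remaining words have rank below that of [expand v], hence below
   the maximum. *)
case/(seq_arg_max (rank \o expand)) => w wp wmax.
suff : p@_w == 0 by rewrite mcoeff_eq0 => /negP; apply.
have := congr1 (mcoeff (expand w)) Ep; rewrite mcoeff0 {1}[p]monalgE eval_sum.
rewrite raddf_sum /= (bigD1_seq w) //=; last exact: finmap.fset_uniq.
rewrite big1_seq ?addr0 => [|v /andP[vw vp]].
  rewrite eval_word mcoeffZ => /eqP; rewrite mulf_eq0 => /orP[//|/eqP E1].
  have := @leading_evalw w; rewrite /leading /supported => /(_ (expand w)).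
  rewrite mcoeffB E1 mcoeffU1 eqxx sub0r oppr_eq0 oner_neq0 => /(_ isT) [_].
  by rewrite ltnn.
rewrite eval_word mcoeffZ; have [->|E1] := eqVneq ((evalw adpoly v)@_(expand w)) 0.
  by rewrite mulr0.
have := @leading_evalw v => /(_ (expand w)).
have neq : (expand v == expand w) = false.
  by apply/negbTE; apply: contraNneq vw => /expand_inj ->.
rewrite mcoeffB mcoeffU1 neq subr0 => /(_ E1) [_].
by rewrite ltnNge wmax.
Qed.

Lemma supported_adpoly i : supported (has (predC1 x)) (adpoly i).
Proof.
case: i => n z; rewrite /adpoly /=; elim: n => [|n IH] /=.
  by apply: supported_word; rewrite /= (valP z).
apply: supportedB.
  apply: (@supportedM _ _ (fun=> True) (has (predC1 x))) => // u v _.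
  by rewrite has_cat => ->; rewrite orbT.
apply: supportedZ; apply: (@supportedM _ _ (has (predC1 x)) (fun=> True)) => //.
by move=> u v; rewrite has_cat => ->.
Qed.

End AdPolynomials.
End Elimination.

(** * Elimination of a letter in a color Lie superalgebra *)

Section SpanIndep.
Variable K : fieldType.
Implicit Types V W : lmodType K.

Fixpoint span V (s : seq V) (v : V) : Prop :=
  if s is u :: s' then exists k : K, span s' (v - k *: u) else v = 0.

(** Independence is tested one vector at a time against the tail, matching the elimination, which
    puts x and [x, x] in front of a basis already found. *)
Fixpoint indep V (s : seq V) : Prop :=
  if s is u :: s' then (forall k : K, span s' (k *: u) -> k = 0) /\ indep s'
  else True.

Lemma span0 V (s : seq V) : span s 0.
Proof. by elim: s => //= u s IH; exists 0; rewrite scale0r subr0. Qed.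

Lemma span_linear V (s : seq V) k u v :
  span s u -> span s v -> span s (k *: u + v).
Proof.
elim: s u v => [|w s IH] u v /=; first by move=> -> ->; rewrite scaler0 addr0.
move=> [a Ha] [b Hb]; exists (k * a + b).
have -> : k *: u + v - (k * a + b) *: w = k *: (u - a *: w) + (v - b *: w).
  by rewrite scalerBr scalerDl scalerA opprD addrACA.
exact: IH.
Qed.

Lemma span_cons V (s : seq V) u v : span s v -> span (u :: s) v.
Proof. by move=> Hv; exists 0; rewrite scale0r subr0. Qed.

Lemma mem_span V (s : seq V) v : v \in s -> span s v.
Proof.
elim: s => // u s IH; rewrite inE => /orP[/eqP ->|/IH]; last exact: span_cons.
by exists 1; rewrite scale1r subrr; apply: span0.
Qed.

Lemma span_trans V (s t : seq V) v :
  (forall u, u \in s -> span t u) -> span s v -> span t v.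
Proof.
elim: s v => [|w s IH] v Hs /=; first by move=> ->; apply: span0.
move=> [k /IH Hk]; rewrite -[v](subrK (k *: w)) addrC; apply: span_linear.
  by apply: Hs; rewrite inE eqxx.
by apply: Hk => u us; apply: Hs; rewrite inE us orbT.
Qed.

Lemma indep_subseq V (s t : seq V) : subseq s t -> indep t -> indep s.
Proof.
elim: t s => [|u t IH] [|v s] //=; case: eqP => [->|_] st [Hu Ht]; last exact: (IH (v :: s)).
split; last exact: IH.
move=> k Hk; apply: Hu; apply: span_trans Hk => w ws; apply: mem_span.
exact: mem_subseq st _ ws.
Qed.

Lemma span_map V W (f : V -> W) (s : seq V) v :
  linear f -> span s v -> span (map f s) (f v).
Proof.
move=> linf; pose F : {linear V -> W} := HB.pack f (GRing.isLinear.Build _ _ _ _ f linf).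
elim: s v => [|u s IH] v /=; first by move=> ->; rewrite -[f]/(F : V -> W) raddf0.
move=> [k /IH Hk]; exists k.
by move: Hk; rewrite addrC -scaleNr linf scaleNr addrC.
Qed.

Lemma indep_map V W (f : V -> W) (s : seq V) :
  linear f -> indep (map f s) -> indep s.
Proof.
move=> linf; elim: s => //= u s IH [Hu /IH Hs]; split => // k Hk; apply: Hu.
have := span_map linf Hk.
pose F : {linear V -> W} := HB.pack f (GRing.isLinear.Build _ _ _ _ f linf).
by rewrite -[f]/(F : V -> W) linearZ.
Qed.

End SpanIndep.

(** A coloring on a commutative monoid: the degrees used below include eigenvalues and heights and
    need not have opposites. *)
Record bicharacter (K : fieldType) (J : nmodType) (chi : J -> J -> K) : Prop :=
  Bicharacter {
    chiDl : forall a b c, chi (a + b) c = chi a c * chi b c;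
    chiDr : forall a b c, chi a (b + c) = chi a b * chi a c;
    chiC : forall a b, chi a b * chi b a = 1 }.

Section ColorBracket.
Variables (K : fieldType) (J : nmodType) (chi : J -> J -> K).

(* H d contains the elements of degree d, but the sum of the H d is not
   required to be direct. *)
Record color_bracket (S : lmodType K) (H : J -> set S) (br : S -> S -> S) :
  Prop := ColorBracket {
    cb_lin : forall d c u v, H d u -> H d v -> H d (c *: u + v);
    cb_0 : forall d, H d 0;
    cb_linl : forall v, linear (br^~ v);
    cb_linr : forall u, linear (br u);
    cb_deg : forall d e u v, H d u -> H e v -> H (d + e) (br u v);
    cb_antisym : forall d e u v, H d u -> H e v ->
      br u v = - (chi d e *: br v u);
    cb_jacobi : forall d e u v w, H d u -> H e v ->
      br u (br v w) = br (br u v) w + chi d e *: br v (br u w) }.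

Inductive lie_span (S : lmodType K) (br : S -> S -> S) (Y : Type)
    (deg : Y -> J) (y : Y -> S) : J -> S -> Prop :=
| lie_span_gen i : lie_span br deg y (deg i) (y i)
| lie_span0 d : lie_span br deg y d 0
| lie_span_linear d c u v : lie_span br deg y d u -> lie_span br deg y d v ->
    lie_span br deg y d (c *: u + v)
| lie_span_br d e u v : lie_span br deg y d u -> lie_span br deg y e v ->
    lie_span br deg y (d + e) (br u v).

Definition degw (Y : choiceType) (deg : Y -> J) (w : word Y) : J :=
  \sum_(i <- w) deg i.

Definition with_squares (ls : seq J) : seq J :=
  flatten [seq if chi d d == -1 then [:: d; d + d] else [:: d] | d <- ls].

End ColorBracket.

Section ColorElimination.
Variables (K : fieldType) (J : nmodType) (chi : J -> J -> K).
Hypotheses (Hchi : bicharacter chi) (two : 2 != 0 :> K) (three : 3 != 0 :> K).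
Variables (S : lmodType K) (H : J -> set S) (br : S -> S -> S).
Hypothesis cb : color_bracket chi H br.

Lemma chi_sqr d : chi d d = 1 \/ chi d d = -1.
Proof.
have /eqP := chiC Hchi d d; rewrite -expr2 sqrf_eq1.
by case/orP => /eqP; [left|right].
Qed.

Let brl v : {linear S -> S} := HB.pack (br^~ v)
  (GRing.isLinear.Build _ _ _ _ (br^~ v) (cb_linl cb v)).
Let brr v : {linear S -> S} := HB.pack (br v)
  (GRing.isLinear.Build _ _ _ _ (br v) (cb_linr cb v)).

Lemma br0l v : br 0 v = 0. Proof. exact: (raddf0 (brl v)). Qed.
Lemma br0r v : br v 0 = 0. Proof. exact: (raddf0 (brr v)). Qed.
Lemma brZl c u v : br (c *: u) v = c *: br u v.
Proof. by have := cb_linl cb v c u 0; rewrite /= addr0 br0l addr0. Qed.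
Lemma brZr c u v : br u (c *: v) = c *: br u v.
Proof. by have := cb_linr cb u c v 0; rewrite addr0 br0r addr0. Qed.
Lemma brDl u u' v : br (u + u') v = br u v + br u' v.
Proof. exact: (raddfD (brl v)). Qed.
Lemma brDr u v v' : br u (v + v') = br u v + br u v'.
Proof. exact: (raddfD (brr u)). Qed.

Lemma neg_self_eq0 (v : S) : v = - v -> v = 0.
Proof.
move=> /eqP; rewrite -addr_eq0 -mulr2n -scaler_nat scaler_eq0 (negPf two).
by move=> /eqP.
Qed.

Lemma br_even d u : H d u -> chi d d = 1 -> br u u = 0.
Proof.
by move=> Hu c1; apply: neg_self_eq0; rewrite {1}(cb_antisym cb Hu Hu) c1 scale1r.
Qed.

(** For odd u, the Jacobi identity on u, u, u reads t = -t - t with t = [u, [u, u]], so 3t = 0. *)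
Lemma br_square d u : H d u -> br u (br u u) = 0.
Proof.
move=> Hu; case: (chi_sqr d) => [/(br_even Hu) ->|c1]; first exact: br0r.
have := cb_jacobi cb u Hu Hu.
rewrite (cb_antisym cb (cb_deg cb Hu Hu) Hu) (chiDl Hchi) c1 mulrNN mulr1 scale1r.
rewrite scaleN1r; set t := br u (br u u) => tE.
have /eqP : 3 *: t = 0.
  by rewrite scaler_nat mulrS mulr2n {1}tE addrACA !addNr addr0.
by rewrite scaler_eq0 (negPf three) => /eqP.
Qed.

Lemma lie_span_H (Y : choiceType) (deg : Y -> J) (y : Y -> S) d u :
  (forall i, H (deg i) (y i)) -> lie_span br deg y d u -> H d u.
Proof.
move=> Hy; elim => {d u} // [d|d c u v _ Hu _ Hv|d e u v _ Hu _ Hv].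
- exact: (cb_0 cb).
- exact: (cb_lin cb _ Hu Hv).
- exact: (cb_deg cb Hu Hv).
Qed.

(** This is the base case of the elimination: in a degree that no word attains, the generated
    subalgebra vanishes. *)
Lemma lie_span_word (Y : choiceType) (deg : Y -> J) (y : Y -> S) d u :
  lie_span br deg y d u -> u != 0 -> exists w : word Y, degw deg w = d.
Proof.
elim => {d u} [i _|d|d c u v _ IHu _ IHv|d e u v _ IHu _ IHv].
- by exists [:: i]; rewrite /degw big_seq1.
- by rewrite eqxx.
- have [->|/IHu //] := eqVneq u 0; have [->|/IHv //] := eqVneq v 0.
  by rewrite scaler0 addr0 eqxx.
- have [->|/IHu [w wd]] := eqVneq u 0; first by rewrite br0l eqxx.
  have [->|/IHv [w' wd']] := eqVneq v 0; first by rewrite br0r eqxx.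
  by move=> _; exists (w ++ w'); rewrite /degw big_cat /= -!/(degw _ _) wd wd'.
Qed.

Lemma lie_span_sub (Y Z : choiceType) (deg : Y -> J) (y : Y -> S)
    (deg' : Z -> J) (y' : Z -> S) d u :
  (forall i, lie_span br deg y (deg' i) (y' i)) ->
  lie_span br deg' y' d u -> lie_span br deg y d u.
Proof.
move=> Hy'; elim => {d u} //.
- by move=> d; apply: lie_span0.
- by move=> d c u v _ Hu _ Hv; apply: lie_span_linear.
- by move=> d e u v _ Hu _ Hv; apply: lie_span_br.
Qed.

Section Letter.
Variables (Y : choiceType) (deg : Y -> J) (y : Y -> S) (x : Y).
Hypothesis Hy : forall i, H (deg i) (y i).

Notation Y' := (nat * {z : Y | z != x})%type.

Definition ad_deg (i : Y') : J := deg x *+ i.1 + deg (val i.2).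
Definition ad_gen (i : Y') : S := iter i.1 (br (y x)) (y (val i.2)).

Lemma ad_degS n z : ad_deg (n.+1, z) = deg x + ad_deg (n, z).
Proof. by rewrite /ad_deg /= mulrS addrA. Qed.

Lemma lie_span_ad_gen i : lie_span br deg y (ad_deg i) (ad_gen i).
Proof.
case: i => n z; elim: n => [|n IH]; rewrite /ad_gen /=.
  by rewrite /ad_deg /= mulr0n add0r; apply: lie_span_gen.
by rewrite ad_degS; apply: lie_span_br => //; apply: lie_span_gen.
Qed.

Lemma ad_gen_H i : H (ad_deg i) (ad_gen i).
Proof. exact: (lie_span_H Hy (lie_span_ad_gen i)). Qed.

Notation lie_span' := (lie_span br ad_deg ad_gen).

Lemma lie_span'_Z d c u : lie_span' d u -> lie_span' d (c *: u).
Proof.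
by move=> Hu; rewrite -[_ *: _]addr0; apply: lie_span_linear => //; apply: lie_span0.
Qed.

Lemma lie_span'_D d u v : lie_span' d u -> lie_span' d v -> lie_span' d (u + v).
Proof. by move=> Hu Hv; rewrite -[u]scale1r; apply: lie_span_linear. Qed.

(** ad(x) is a color derivation that sends the generator ad(x)^n z to the next one, so it preserves
    the subalgebra they generate. *)
Lemma lie_span'_ad d u : lie_span' d u -> lie_span' (deg x + d) (br (y x) u).
Proof.
elim => {d u} [[n z]|d|d c u v _ Hu _ Hv|d e u v Su Hu Sv Hv].
- by rewrite -ad_degS; apply: (lie_span_gen _ _ _ (n.+1, z)).
- by rewrite br0r; apply: lie_span0.
- by rewrite brDr brZr; apply: lie_span_linear.
- rewrite (cb_jacobi cb v (Hy x) (lie_span_H ad_gen_H Su)).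
  rewrite {1}addrA; apply: lie_span'_D; first exact: lie_span_br.
  by rewrite -addrA addrCA; apply/lie_span'_Z/lie_span_br.
Qed.

(* Lazard elimination: the span of x, of [x, x] when x is odd, and of the
   subalgebra generated by the ad(x)^n z is closed under the bracket. *)
Inductive eliminated : J -> S -> Prop :=
| eliminated_x : eliminated (deg x) (y x)
| eliminated_xx : chi (deg x) (deg x) = -1 ->
    eliminated (deg x + deg x) (br (y x) (y x))
| eliminated' d u : lie_span' d u -> eliminated d u
| eliminated_linear d c u v : eliminated d u -> eliminated d v ->
    eliminated d (c *: u + v).

Lemma eliminated0 d : eliminated d 0.
Proof. by apply: eliminated'; apply: lie_span0. Qed.

Lemma eliminated_Z d c u : eliminated d u -> eliminated d (c *: u).
Proof.
move=> Hu; rewrite -[_ *: _]addr0; apply: eliminated_linear => //.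
exact: eliminated0.
Qed.

Lemma eliminated_anti d e u v : H d u -> H e v ->
  eliminated (e + d) (br v u) -> eliminated (d + e) (br u v).
Proof.
move=> Hu Hv E; rewrite (cb_antisym cb Hu Hv) -scaleN1r addrC.
by do 2!apply: eliminated_Z.
Qed.

Lemma eliminated_br d e u v :
  eliminated d u -> eliminated e v -> eliminated (d + e) (br u v).
Proof.
have Hxx := cb_deg cb (Hy x) (Hy x).
(* For odd x, ad([x, x]) = 2 ad(x)^2. Brackets with [x, x] thus reduce to brackets with x. *)
have xxE w : chi (deg x) (deg x) = -1 ->
    br (br (y x) (y x)) w = 2 *: br (y x) (br (y x) w).
  move=> c1; have := cb_jacobi cb w (Hy x) (Hy x).
  by rewrite c1 scaleN1r => /eqP; rewrite -subr_eq opprK eq_sym -mulr2n scaler_nat => /eqP.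
have ad_x b w : eliminated b w -> eliminated (deg x + b) (br (y x) w).
  elim => {b w} [|c1|b w Hw|b c w w' _ Hw _ Hw'].
  - have [/(br_even (Hy x)) ->|c1] := chi_sqr (deg x); first exact: eliminated0.
    exact: eliminated_xx.
  - by rewrite (br_square (Hy x)); apply: eliminated0.
  - by apply: eliminated'; apply: lie_span'_ad.
  - by rewrite brDr brZr; apply: eliminated_linear.
move=> Hu; elim: Hu e v => {d u} [|c1|d u Su|d c u u' _ IHu _ IHu'] e v Hv.
- exact: ad_x.
- by rewrite xxE // -addrA; apply/eliminated_Z/ad_x/ad_x.
- have Hu := lie_span_H ad_gen_H Su.
  elim: Hv => {e v} [|c1|e v Sv|e c v v' _ Hv _ Hv'].
  + by apply: eliminated_anti => //; apply: ad_x; apply: eliminated'.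
  + apply: eliminated_anti => //; rewrite xxE // -addrA.
    by apply/eliminated_Z/ad_x/ad_x/eliminated'.
  + by apply: eliminated'; apply: lie_span_br.
  + by rewrite brDr brZr; apply: eliminated_linear.
- by rewrite brDl brZl; apply: eliminated_linear; [apply: IHu|apply: IHu'].
Qed.

Lemma lie_span_eliminated d u : lie_span br deg y d u -> eliminated d u.
Proof.
elim => {d u} [i|d|d c u v _ Hu _ Hv|d e u v _ Hu _ Hv].
- have [->|ix] := eqVneq i x; first exact: eliminated_x.
  apply: eliminated'; have := lie_span_gen br ad_deg ad_gen (0%N, exist _ i ix).
  by rewrite /ad_deg /ad_gen /= mulr0n add0r.
- exact: eliminated0.
- exact: eliminated_linear.
- exact: eliminated_br.
Qed.

Variables (X : choiceType) (F : S -> free_alg K X).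
Hypotheses (linF : linear F)
  (Fbr : forall d e u v, lie_span br deg y d u -> lie_span br deg y e v ->
    F (br u v) = F u * F v - chi d e *: (F v * F u)).

Definition ad_coef n (z : {z : Y | z != x}) : K := chi (deg x) (ad_deg (n, z)).

Lemma F_ad_gen i : F (ad_gen i) = eval (F \o y) (adpoly ad_coef i).
Proof.
have FE z : F (y z) = eval (F \o y) (letter z).
  by rewrite eval_word scale1r /evalw big_seq1.
case: i => n z; rewrite /adpoly /ad_gen /=.
elim: n => [|n IH]; first exact: FE.
rewrite iterS (Fbr (lie_span_gen _ _ _ x) (lie_span_ad_gen (n, z))).
by rewrite evalB evalZ !evalM -IH -FE.
Qed.

(** This separates the new subalgebra from x and [x, x], whose images involve only the words x and
    xx. *)
Lemma F_lie_span' d u : lie_span' d u ->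
  exists2 p, F u = eval (F \o y) p & supported (has (predC1 x)) p.
Proof.
pose Fl : {linear S -> free_alg K X} :=
  HB.pack F (GRing.isLinear.Build _ _ _ _ F linF).
elim => {d u} [i|d|d c u v _ [p Fu Pp] _ [q Fv Pq]|d e u v Su [p Fu Pp] Sv [q Fv Pq]].
- by exists (adpoly ad_coef i); [apply: F_ad_gen|apply: supported_adpoly].
- exists 0; last exact: supported0.
  by rewrite eval0; apply: (raddf0 Fl).
- exists (c *: p + q); last by apply: supportedD => //; apply: supportedZ.
  by rewrite linF evalD evalZ Fu Fv.
- exists (p * q - chi d e *: (q * p)).
    rewrite evalB evalZ !evalM -Fu -Fv; apply: Fbr.
      exact: (lie_span_sub lie_span_ad_gen Su).
    exact: (lie_span_sub lie_span_ad_gen Sv).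
  apply: supportedB; last apply: supportedZ.
    by apply: supportedM Pp Pq => a b; rewrite has_cat => ->.
  by apply: supportedM Pq Pp => a b; rewrite has_cat => ->.
Qed.

End Letter.
End ColorElimination.

Lemma preimages_in_list (T U : eqType) (f : T -> U) (us : seq U) :
  injective f ->
  exists ts : seq T, (size ts <= size us)%N /\ forall t, f t \in us -> t \in ts.
Proof.
move=> finj; elim: us => [|u us [ts [szts tsP]]]; first by exists [::].
have [[t ft]|nt] := pselect (exists t, f t = u).
  exists (t :: ts); split => // t'; rewrite !inE -ft.
  by case/orP => [/eqP/finj ->|/tsP ->]; rewrite ?eqxx ?orbT.
exists ts; split; first exact: leqW.
move=> t'; rewrite inE => /orP[/eqP ft|/tsP //].
by case: nt; exists t'.
Qed.

(** * Bases obtained by iterated elimination *)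

Section EliminationBasis.
Variables (K : fieldType) (J : nmodType).
Hypotheses (two : 2 != 0 :> K) (three : 3 != 0 :> K).

(* The list ls consists of the degrees of the eliminated letters; it depends on
   the alphabet but not on the commutation factor chi, which only decides which
   of these degrees contribute a square. *)
Definition lie_basis (tgt : set J) (chi : J -> J -> K) (Y : choiceType)
    (deg : Y -> J) (ls : seq J) (S : lmodType K) (br : S -> S -> S)
    (y : Y -> S) (bs : seq (J * S)) : Prop :=
  [/\ [seq e.1 | e <- bs] = with_squares chi ls,
      forall e, e \in bs -> lie_span br deg y e.1 e.2,
      forall d u, tgt d -> lie_span br deg y d u ->
        span [seq e.2 | e <- bs & e.1 == d] u
    & forall (X : choiceType) (F : S -> free_alg K X), linear F ->
        (forall d e u v, lie_span br deg y d u -> lie_span br deg y e v ->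
          F (br u v) = F u * F v - chi d e *: (F v * F u)) ->
        (forall p, eval (F \o y) p = 0 -> p = 0) ->
        indep [seq F e.2 | e <- bs]].

Lemma degw_expand (Y : choiceType) (deg : Y -> J) (x : Y) w :
  degw deg (expand w) = degw (ad_deg (x := x) deg) w.
Proof.
elim: w => [|[n z] w IH]; first by rewrite /degw !big_nil.
rewrite /degw big_cons -/(degw _ w) -IH /expand /= big_cat /=; congr (_ + _).
rewrite /letter_word -cats1 big_cat big_seq1 /=; congr (_ + _).
by rewrite big_nseq; elim: n => //= n ->; rewrite mulrS.
Qed.

Lemma lie_basis_exists (tgt : set J) (Y : choiceType) (deg : Y -> J)
    (ws : seq (word Y)) :
  ~ tgt 0 -> (forall w, tgt (degw deg w) -> w \in ws) ->
  exists ls : seq J, forall (chi : J -> J -> K) (S : lmodType K)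
    (H : J -> set S) (br : S -> S -> S) (y : Y -> S),
    bicharacter chi -> color_bracket chi H br -> (forall i, H (deg i) (y i)) ->
    exists bs, lie_basis tgt chi deg ls br y bs.
Proof.
(* Induction on the number of words with target degree: after the elimination
   of x, the words in the new letters ad(x)^n z expand to words in the old
   letters which do not end in x. *)
move=> tgt0; have [n] := ubnP (size ws); elim: n Y deg ws => // n IH Y deg ws szws wsP.
have [[w tw]|no_word] := pselect (exists w, tgt (degw deg w)); last first.
  (* No word has target degree, so the target components are zero and the empty list spans them. *)
  exists [::] => chi S H br y Hchi cb Hy; exists [::]; split => //= d u td du.
  have [//|u0] := eqVneq u 0; have [w wd] := lie_span_word cb du u0.
  by case: no_word; exists w; rewrite wd.
case: w tw => [|x v tw]; first by rewrite /degw big_nil => /tgt0.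
(* Degrees commute, so moving the leading x to the end keeps the degree. The rotated word is listed
   but is no expansion, whence the new list is strictly shorter. *)
have wsx : rcons v x \in ws.
  apply: wsP; suff -> : degw deg (rcons v x) = degw deg (x :: v) by [].
  by rewrite /degw -cats1 big_cat big_seq1 big_cons addrC.
have [ws' [szws' ws'P]] :=
  preimages_in_list [seq w <- ws | w != rcons v x] (@expand_inj Y x).
have lt_ws' : (size ws' < n)%N.
  apply: leq_ltn_trans szws' _; rewrite size_filter.
  rewrite -ltnS; apply: leq_trans szws; rewrite ltnS.
  rewrite -(count_predC (fun w => w != rcons v x) ws) -addn1 leq_add2l -has_count.
  by apply/hasP; exists (rcons v x) => //=; rewrite eqxx.
have tgt' w : tgt (degw (ad_deg (x := x) deg) w) -> w \in ws'.
  rewrite -degw_expand => /wsP ws_w; apply: ws'P; rewrite mem_filter ws_w andbT.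
  by apply/eqP; apply: expand_rcons_neq.
have [ls lsP] := IH _ _ _ lt_ws' tgt'.
exists (deg x :: ls) => chi S H br y Hchi cb Hy.
have [bs [bs_deg bs_in bs_span bs_indep]] :=
  lsP chi S H br (ad_gen br y (x := x)) Hchi cb (ad_gen_H cb (x := x) Hy).
pose sq := if chi (deg x) (deg x) == -1
  then [:: (deg x + deg x, br (y x) (y x))] else [::].
exists ((deg x, y x) :: sq ++ bs); split.
- by rewrite /sq /with_squares /=; case: eqP => _ /=; rewrite bs_deg.
- move=> e; rewrite inE mem_cat => /or3P[/eqP ->|esq|/bs_in].
  + exact: lie_span_gen.
  + move: esq; rewrite /sq; case: eqP => // _; rewrite inE => /eqP -> /=.
    by apply: lie_span_br; apply: lie_span_gen.
  + by apply: lie_span_sub => i; apply: lie_span_ad_gen.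
- move=> d u td /(lie_span_eliminated Hchi two three cb x Hy) Eu.
  elim: Eu td => {d u} [|c1|d u Su|d c u u' _ IHu _ IHu'] td.
  + by rewrite /= eqxx; apply: mem_span; rewrite inE eqxx.
  + apply: mem_span; apply/mapP; exists (deg x + deg x, br (y x) (y x)) => //.
    by rewrite mem_filter eqxx inE mem_cat /sq c1 eqxx inE eqxx orbT.
  + apply: span_trans (bs_span _ _ td Su) => w /mapP[e]; rewrite mem_filter.
    move=> /andP[ed ebs] ->; apply/mem_span/map_f.
    by rewrite mem_filter ed inE mem_cat ebs !orbT.
  + by apply: span_linear; [apply: IHu|apply: IHu'].
- move=> X F linF Fbr Finj; have Fx : F (y x) = eval (F \o y) (letter x).
    by rewrite eval_word scale1r /evalw big_seq1.
  have Fbs : indep [seq F e.2 | e <- bs].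
    apply: bs_indep => // [d e u u' Su Su'|p Ep].
      by apply: Fbr; [move: Su|move: Su']; apply: lie_span_sub => i;
         apply: lie_span_ad_gen.
    have E : F \o ad_gen br y (x := x) =1
        (fun i => eval (F \o y) (adpoly (ad_coef chi deg (x:=x)) i)).
      by move=> i; apply: F_ad_gen.
    move: Ep; rewrite (eval_ext p E) eval_comp => /Finj.
    exact: eval_adpoly_inj.
  (* Injectivity of evaluation makes [q] unique, so membership in the span of the remaining basis
     forces each word of [q] to contain a letter other than x. *)
  have proper q : span [seq F e.2 | e <- bs] (eval (F \o y) q) ->
      supported (has (predC1 x)) q.
    have := @F_lie_span' _ _ _ _ _ _ _ _ x _ _ linF Fbr.
    elim: bs bs_in {bs_deg bs_span bs_indep Fbs} q => [|e bs IHbs] bs_in q FP /=.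
      by move=> /Finj ->; apply: supported0.
    have [p Fp Pp] := FP _ _ (bs_in e (mem_head _ _)).
    move=> [k]; rewrite Fp -evalZ -evalB => /IHbs Pq.
    rewrite -[q](subrK (k *: p)); apply: supportedD; last exact: supportedZ.
    by apply: Pq => // e' e'bs; apply: bs_in; rewrite inE e'bs orbT.
  have Fxx : chi (deg x) (deg x) = -1 ->
      F (br (y x) (y x)) = eval (F \o y) (2 *: (letter x * letter x)).
    move=> c1; rewrite (Fbr _ _ _ _ (lie_span_gen _ _ _ x) (lie_span_gen _ _ _ x)).
    by rewrite c1 scaleN1r opprK Fx evalZ evalM scaler_nat mulr2n.
  have letter2 : letter x * letter x = << [:: x; x] >> :> free_alg K Y.
    by rewrite malgM_def fgmulUU mulr1.
  rewrite /= map_cat /sq; case: eqP => [c1|_] /=; last first.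
    split=> // k; rewrite Fx -evalZ => /proper /(_ [:: x]).
    rewrite mcoeffZ mcoeffU1 eqxx mulr1 /= eqxx orbF => P.
    by apply/eqP/negPn/negP => /P.
  (* The coefficient at the word x kills the multiple of x; the one at xx then kills the multiple of
     [x, x], as 2 is nonzero. *)
  rewrite (Fxx c1) Fx; split=> [k [k']|]; last split=> // k.
    rewrite -!evalZ -evalB letter2 => /proper /(_ [:: x]).
    have neq : ([:: x; x] == [:: x] :> word Y) = false by apply/eqP.
    rewrite mcoeffB !mcoeffZ !mcoeffU1 neq !eqxx mulr1 !mulr0 subr0 /= eqxx.
    by move=> P; apply/eqP/negPn/negP => /P.
  rewrite -evalZ letter2 => /proper /(_ [:: x; x]).
  rewrite !mcoeffZ !mcoeffU1 eqxx mulr1 /= eqxx => P.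
  apply/eqP/negPn/negP => k0; have : k * 2 != 0 by rewrite mulf_neq0.
  by move/P.
Qed.

End EliminationBasis.

(** * Traces of triangular maps *)

Section Trace.
Variables (K : fieldType) (V : lmodType K).

(** The change-of-basis matrices [C] and [D] are mutually inverse and [M *m C = C *m M']. Cyclicity
    of the trace holds for rectangular products, so the two bases need not be known to have equal
    size. *)
Lemma trace_on_basis (f : V -> V) (W : set V) (n : nat) (b : 'I_n -> V)
    (M : 'M[K]_n) :
  linear f -> is_basis W b -> (forall j, f (b j) = \sum_i M i j *: b i) ->
  trace_on f W = \tr M.
Proof.
move=> linf bW fb; apply: xget_unique; first by exists n, b, M.
move=> _ [n' [b' [M' [b'W fb' ->]]]].
pose fl : {linear V -> V} := HB.pack f (GRing.isLinear.Build _ _ _ _ f linf).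
have flE m (c : 'I_m -> K) (e : 'I_m -> V) : f (\sum_i c i *: e i) = \sum_i c i *: f (e i).
  have f0 : f 0 = 0 := raddf0 fl.
  rewrite -[f]/(fl : V -> V) raddf_sum; apply: eq_bigr => i _ /=.
  by rewrite -[_ *: _]addr0 linf f0 addr0.
have basis_mem m (e : 'I_m -> V) i : is_basis W e -> W (e i).
  case=> -> _; exists (fun k => (k == i)%:R).
  rewrite (bigD1 i) //= eqxx scale1r big1 ?addr0 // => k /negPf ->.
  by rewrite scale0r.
have coords m (e : 'I_m -> V) m' (e' : 'I_m' -> V) : is_basis W e ->
    is_basis W e' ->
    exists C : 'M[K]_(m, m'), forall j, e' j = \sum_i C i j *: e i.
  move=> We We'.
  have /choice[c cP] : forall j, exists c : 'I_m -> K, e' j = \sum_i c i *: e i.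
    by move=> j; have := basis_mem _ _ j We'; case: We => {1}-> _.
  by exists (\matrix_(i, j) c j i) => j; rewrite cP; apply: eq_bigr => i _; rewrite mxE.
have [C Cb] := coords _ _ _ _ bW b'W; have [D Db] := coords _ _ _ _ b'W bW.
have mulE m m' m'' (e : 'I_m -> V) (P : 'M[K]_(m, m')) (Q : 'M[K]_(m', m'')) j :
    \sum_k Q k j *: \sum_i P i k *: e i = \sum_i (P *m Q) i j *: e i.
  under eq_bigr do rewrite scaler_sumr.
  rewrite exchange_big; apply: eq_bigr => i _; rewrite mxE scaler_suml.
  by apply: eq_bigr => k _; rewrite scalerA mulrC.
have coord_inj m (e : 'I_m -> V) m' (P Q : 'M[K]_(m, m')) : is_basis W e ->
    (forall j, \sum_i P i j *: e i = \sum_i Q i j *: e i) -> P = Q.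
  move=> [_ efree] PQ; apply/matrixP => i j; apply/eqP; rewrite -subr_eq0.
  apply/eqP; apply: (efree (fun i => P i j - Q i j)).
  under eq_bigr do rewrite scalerBl.
  by rewrite sumrB PQ subrr.
have sum1 m (e : 'I_m -> V) j : \sum_i (1%:M : 'M[K]_m) i j *: e i = e j.
  rewrite (bigD1 j) //= mxE eqxx scale1r big1 ?addr0 // => i /negPf ij.
  by rewrite mxE ij scale0r.
have CD : C *m D = 1%:M.
  apply: (coord_inj _ _ _ _ _ bW) => j; rewrite sum1 -mulE [RHS]Db.
  by apply: eq_bigr => k _; rewrite -Cb.
have DC : D *m C = 1%:M.
  apply: (coord_inj _ _ _ _ _ b'W) => j; rewrite sum1 -mulE [RHS]Cb.
  by apply: eq_bigr => k _; rewrite -Db.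
have MC : M *m C = C *m M'.
  apply: (coord_inj _ _ _ _ _ bW) => j; rewrite -!mulE.
  transitivity (f (b' j)).
    by rewrite Cb flE; apply: eq_bigr => k _; rewrite fb.
  by rewrite fb'; apply: eq_bigr => k _; rewrite -Cb.
by rewrite -[M']mul1mx -DC -mulmxA -MC mxtrace_mulC -mulmxA CD mulmx1.
Qed.

Variables (T : eqType) (e0 : T) (vec : T -> V).
Implicit Types es : seq T.

Lemma span_filterP es (P : pred T) v :
  span [seq vec e | e <- es & P e] v -> exists c : nat -> K,
    v = \sum_(i < size es) c i *: vec (nth e0 es i) /\
    forall i, ~~ P (nth e0 es i) -> c i = 0.
Proof.
elim: es v => [|e es IH] v /=.
  by move=> ->; exists (fun=> 0); rewrite big_ord0.
case: ifP => Pe /=.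
  move=> [k /IH [c [vE cP]]]; exists (fun i => if i is j.+1 then c j else k).
  split; first by rewrite big_ord_recl /= -vE addrC subrK.
  by case=> [|i] /=; [rewrite Pe|apply: cP].
move=> /IH [c [vE cP]]; exists (fun i => if i is j.+1 then c j else 0).
split; first by rewrite big_ord_recl /= scale0r add0r.
by case=> [|i] //=; apply: cP.
Qed.

Lemma sum_span es (c : nat -> K) :
  span [seq vec e | e <- es] (\sum_(i < size es) c i *: vec (nth e0 es i)).
Proof.
elim: es c => [|e es IH] c /=; first by rewrite big_ord0.
exists (c 0%N); rewrite big_ord_recl /= addrC addKr.
exact: (IH (fun i => c i.+1)).
Qed.

Lemma indep_sum0 es (c : nat -> K) : indep [seq vec e | e <- es] ->
  \sum_(i < size es) c i *: vec (nth e0 es i) = 0 ->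
  forall i, (i < size es)%N -> c i = 0.
Proof.
elim: es c => [|e es IH] c //= [He Hes]; rewrite big_ord_recl /= => sum0.
have c0 : c 0%N = 0.
  apply/eqP; rewrite -oppr_eq0; apply/eqP/He; rewrite scaleNr.
  have -> : - (c 0%N *: vec e) =
      \sum_(i < size es) c i.+1 *: vec (nth e0 es i).
    by apply/eqP; rewrite eq_sym -addr_eq0 addrC sum0.
  exact: (sum_span _ (fun i => c i.+1)).
case=> [//|i] /= ltis; apply: (IH (fun i => c i.+1)) => //.
by move: sum0; rewrite c0 scale0r add0r.
Qed.

(** The list need not be sorted by [ht]: strict decrease of the height already makes the diagonal
    entry of the error term zero. *)
Lemma trace_on_triangular (f : V -> V) (W : set V) es (eig : T -> K)
    (ht : T -> nat) :
  linear f -> (forall v, W v <-> span [seq vec e | e <- es] v) ->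
  indep [seq vec e | e <- es] ->
  (forall e, e \in es ->
    span [seq vec e' | e' <- es & (ht e' < ht e)%N] (f (vec e) - eig e *: vec e)) ->
  trace_on f W = \sum_(e <- es) eig e.
Proof.
move=> linf Wspan es_indep f_tri.
pose b (i : 'I_(size es)) := vec (nth e0 es i).
have bW : is_basis W b.
  split.
    rewrite eqEsubset; split=> v.
      move=> /Wspan; have {1}-> : es = [seq e <- es | xpredT e] by rewrite filter_predT.
      by move=> /span_filterP [c [-> _]]; exists (fun i => c i).
    case=> c ->; apply/Wspan.
    pose c' i := if insub i is Some j then c j else 0.
    have -> : \sum_i c i *: b i = \sum_(i < size es) c' i *: vec (nth e0 es i).
      by apply: eq_bigr => i _; rewrite /c' valK.
    exact: sum_span.
  move=> c c0 i.
  pose c' i := if insub i is Some j then c j else 0.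
  have := @indep_sum0 es c' es_indep _ i (ltn_ord i); rewrite /c' valK; apply.
  by rewrite -[RHS]c0; apply: eq_bigr => j _; rewrite valK.
have /choice[N NP] : forall j : 'I_(size es), exists c : nat -> K,
    f (b j) - eig (nth e0 es j) *: b j = \sum_(i < size es) c i *: b i /\
    c j = 0.
  move=> j; have /span_filterP [c [fE cP]] := f_tri _ (mem_nth e0 (ltn_ord j)).
  by exists c; split => //; apply: cP; rewrite ltnn.
rewrite (@trace_on_basis _ _ _ b
  (\matrix_(i, j) (eig (nth e0 es j) * (i == j)%:R + N j i))) //.
  rewrite /mxtrace (big_nth e0) big_mkord; apply: eq_bigr => i _.
  by rewrite mxE eqxx mulr1 (NP i).2 addr0.
move=> j; rewrite -[LHS](subrK (eig (nth e0 es j) *: b j)) (NP j).1 addrC.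
under [RHS]eq_bigr do rewrite mxE scalerDl.
rewrite big_split /=; congr (_ + _).
rewrite (bigD1 j) //= eqxx mulr1 big1 ?addr0 // => i /negPf ->.
by rewrite mulr0 scale0r.
Qed.

End Trace.

(** * Degrees and triangular automorphisms *)

(** The empty word needs a degree. A fresh zero is adjoined even if [I] has one, so that no nonempty
    word has degree [None]. *)
Definition adjoin0 (I : Type) := option I.

Section Adjoin0.
Variable I : addSemigroupType.

HB.instance Definition _ := Choice.on (adjoin0 I).

Definition adjoin0_add (p q : adjoin0 I) : adjoin0 I :=
  match p, q with
  | Some a, Some b => Some (a + b)
  | Some a, None => Some a
  | None, _ => q
  end.

Lemma adjoin0_addA : associative adjoin0_add.
Proof. by move=> [a|] [b|] [c|] //=; rewrite Algebra.addrA. Qed.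

Lemma adjoin0_addC : commutative adjoin0_add.
Proof. by move=> [a|] [b|] //=; rewrite Algebra.addrC. Qed.

Lemma adjoin0_add0 : left_id None adjoin0_add.
Proof. by []. Qed.

HB.instance Definition _ :=
  GRing.isNmodule.Build (adjoin0 I) adjoin0_addA adjoin0_addC adjoin0_add0.

End Adjoin0.

Definition mult_monoid (K : Type) := K.

HB.instance Definition _ (K : fieldType) := Choice.on (mult_monoid K).
HB.instance Definition _ (K : fieldType) :=
  GRing.isNmodule.Build (mult_monoid K) (@mulrA K) (@mulrC K) (@mul1r K).

(* The degree of a letter records its degree in I, its eigenvalue for g (these
   multiply, so the monoid K is multiplicative here) and its position in a flag
   stabilized by g. *)
Definition degree (I : addSemigroupType) (K : fieldType) : nmodType :=
  (adjoin0 I * mult_monoid K * nat)%type.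

Section Degree.
Variables (I : addSemigroupType) (K : fieldType).
Implicit Types d e : degree I K.

Definition idx d : adjoin0 I := d.1.1.
Definition eig d : K := d.1.2.
Definition height d : nat := d.2.

Lemma idxD d e : idx (d + e) = idx d + idx e. Proof. by []. Qed.
Lemma eigD d e : eig (d + e) = eig d * eig e. Proof. by []. Qed.
Lemma heightD d e : height (d + e) = (height d + height e)%N. Proof. by []. Qed.

End Degree.

Section LieClosure.
Variables (K : fieldType) (J : nmodType) (S : lmodType K) (br : S -> S -> S).
Hypotheses (brl : forall v, linear (br^~ v)) (brr : forall u, linear (br u)).
Variables (Y : Type) (deg : Y -> J) (y : Y -> S).

(** Unlike [lie_span], this allows sums over different degrees, as the error terms of a triangular
    map require. *)
Inductive lie_closure (D : set J) : S -> Prop :=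
| lie_closure_span d u : D d -> lie_span br deg y d u -> lie_closure D u
| lie_closure0 : lie_closure D 0
| lie_closure_linear c u v :
    lie_closure D u -> lie_closure D v -> lie_closure D (c *: u + v).

Lemma lie_closureZ D c u : lie_closure D u -> lie_closure D (c *: u).
Proof.
by move=> Du; rewrite -[_ *: _]addr0; apply: lie_closure_linear => //; apply: lie_closure0.
Qed.

Lemma lie_closureD D u v :
  lie_closure D u -> lie_closure D v -> lie_closure D (u + v).
Proof. by move=> Du; rewrite -[u]scale1r; apply: lie_closure_linear. Qed.

Lemma sub_lie_closure D E u :
  D `<=` E -> lie_closure D u -> lie_closure E u.
Proof.
move=> DE; elim => {u} [d u /DE Ed du||c u v _ Eu _ Ev].
- exact: lie_closure_span Ed du.
- exact: lie_closure0.
- exact: lie_closure_linear.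
Qed.

Lemma lie_closure_br (D E F : set J) u v :
  (forall d e, D d -> E e -> F (d + e)) ->
  lie_closure D u -> lie_closure E v -> lie_closure F (br u v).
Proof.
move=> DEF; elim => {u} [d u Dd du||c u u' _ IHu _ IHu'] Ev.
- elim: Ev => {v} [e v Ee ev||c v v' _ Hv _ Hv'].
  + exact: lie_closure_span (DEF _ _ Dd Ee) (lie_span_br du ev).
  + have := brr u (-1) 0 0; rewrite scaler0 addr0 scaleN1r addNr => ->.
    exact: lie_closure0.
  + by rewrite brr; apply: lie_closure_linear.
- have := brl v (-1) 0 0; rewrite /= scaler0 addr0 scaleN1r addNr => ->.
  exact: lie_closure0.
- by have /= -> := brl v c u u'; apply: lie_closure_linear; [apply: IHu|apply: IHu'].
Qed.

End LieClosure.

Section Triangular.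
Variables (I : addSemigroupType) (K : fieldType) (S : lmodType K).
Variables (br : S -> S -> S).
Hypotheses (brl : forall v, linear (br^~ v)) (brr : forall u, linear (br u)).
Variables (Y : Type) (deg : Y -> degree I K) (y : Y -> S).

Definition lower (d : degree I K) : set (degree I K) :=
  [set e | idx e = idx d /\ (height e < height d)%N].

Definition triangular (f : S -> S) (lam : degree I K -> K) : Prop :=
  forall d u, lie_span br deg y d u ->
    lie_closure br deg y (lower d) (f u - lam d *: u).

(** Write f u = lu + u' and f v = mv + v'. Apart from lm[u, v], the bracket [f u, f v] consists of
    multiples of [u, v'], [u', v] and of [u', v'], all of smaller height because heights add. *)
Lemma triangular_automorphism f :
  linear f -> (forall u v, f (br u v) = br (f u) (f v)) ->
  (forall i, lie_closure br deg y (lower (deg i)) (f (y i) - eig (deg i) *: y i)) ->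
  triangular f (@eig I K).
Proof.
move=> linf fbr fy d u.
pose fl : {linear S -> S} := HB.pack f (GRing.isLinear.Build _ _ _ _ f linf).
have f0 : f 0 = 0 := raddf0 fl.
elim => {d u} [i|d|d c u v _ Hu _ Hv|d e u v Hu IHu Hv IHv] //.
- by rewrite f0 scaler0 subr0; apply: lie_closure0.
- rewrite linf scalerDr opprD addrACA scalerA mulrC -scalerA -scalerBr.
  exact: lie_closure_linear.
pose u' := f u - eig d *: u; pose v' := f v - eig e *: v.
have -> : f (br u v) - eig (d + e) *: br u v =
    eig d *: br u v' + (eig e *: br u' v + br u' v').
  have brD a b w : br (a + b) w = br a w + br b w.
    by have := brl w 1 a b; rewrite /= !scale1r.
  have brDr' w a b : br w (a + b) = br w a + br w b.
    by have := brr w 1 a b; rewrite !scale1r.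
  have br0 w : br 0 w = 0.
    by have := brl w (-1) 0 0; rewrite /= scaler0 addr0 scaleN1r addNr.
  have br0r' w : br w 0 = 0.
    by have := brr w (-1) 0 0; rewrite scaler0 addr0 scaleN1r addNr.
  have brZ c a w : br (c *: a) w = c *: br a w.
    by have := brl w c a 0; rewrite /= !addr0 br0 addr0.
  have brZr' c a w : br a (c *: w) = c *: br a w.
    by have := brr a c w 0; rewrite !addr0 br0r' addr0.
  have fu : f u = u' + eig d *: u by rewrite subrK.
  have fv : f v = v' + eig e *: v by rewrite subrK.
  rewrite fbr fu fv; clearbody u' v'.
  rewrite brD !brDr' !brZ !brZr' eigD scalerA !addrA addrK addrC.
  by rewrite [br u' v' + _]addrC addrA.
apply: lie_closure_linear; last apply: lie_closure_linear.
- apply: (lie_closure_br brl brr (D := eq^~ d) _ (lie_closure_span _ Hu) IHv) => //.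
  by move=> a b -> [ib hb]; split; rewrite ?idxD ?ib // !heightD ltn_add2l.
- apply: (lie_closure_br brl brr (E := eq^~ e) _ IHu (lie_closure_span _ Hv)) => //.
  by move=> a b [ia ha] ->; split; rewrite ?idxD ?ia // !heightD ltn_add2r.
- apply: (lie_closure_br brl brr _ IHu IHv) => a b [ia ha] [ib hb].
  by split; rewrite ?idxD ?ia ?ib // !heightD -addSn leq_add // ltnW.
Qed.

(** f^2 - l^2 = (f + l)(f - l), and f preserves the part of lower height. *)
Lemma triangular_square f :
  linear f -> triangular f (@eig I K) ->
  triangular (fun u => f (f u)) (fun d => eig d ^+ 2).
Proof.
move=> linf ftri.
pose fl : {linear S -> S} := HB.pack f (GRing.isLinear.Build _ _ _ _ f linf).
have f0 : f 0 = 0 := raddf0 fl.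
have f_lower d u : lie_closure br deg y (lower d) u ->
    lie_closure br deg y (lower d) (f u).
  elim => {u} [e u de eu||c u v _ Hu _ Hv].
  - rewrite -[f u](subrK (eig e *: u)); apply: lie_closureD.
      apply: sub_lie_closure (ftri _ _ eu) => e' [ie' he'].
      by case: de => ie he; split; [rewrite ie'|apply: ltn_trans he].
    exact/lie_closureZ/(lie_closure_span de).
  - by rewrite f0; apply: lie_closure0.
  - by rewrite linf; apply: lie_closure_linear.
move=> d u du; have low := ftri d u du.
have -> : f (f u) - eig d ^+ 2 *: u =
    f (f u - eig d *: u) + eig d *: (f u - eig d *: u).
  have -> : f (f u - eig d *: u) = f (f u) - eig d *: f u.
    by rewrite addrC -scaleNr linf scaleNr addrC.
  by rewrite scalerBr scalerA -expr2 addrA subrK.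
by apply: lie_closureD; [apply: f_lower|apply: lie_closureZ].
Qed.

End Triangular.

(** * Subalgebras spanned by homogeneous elements *)

Record subspace (K : fieldType) (V : lmodType K) := Subspace {
  carrier : {pred V};
  carrier_closed : submod_closed carrier }.

Section SubspaceType.
Variables (K : fieldType) (V : lmodType K) (W : subspace V).

Definition in_carrier : {pred V} := carrier W.

HB.instance Definition _ :=
  GRing.isSubmodClosed.Build K V in_carrier (carrier_closed W).

Record subspace_sort := SubspaceSort {
  subspace_val :> V;
  subspace_valP : subspace_val \in in_carrier }.

HB.instance Definition _ := [isSub for subspace_val].
HB.instance Definition _ := [Choice of subspace_sort by <:].
HB.instance Definition _ := [SubChoice_isSubLmodule of subspace_sort by <:].

End SubspaceType.

Lemma linear_at0 (K : fieldType) (S : lmodType K) (f : S -> S) :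
  linear f -> f 0 = 0.
Proof.
by move=> linf; have := linf (-1) 0 0; rewrite scaler0 addr0 scaleN1r addNr.
Qed.

Section SumOfHomogeneous.
Variables (K : fieldType) (A : zmodType) (theta : A -> A -> K).
Variables (Gam : addSemigroupType) (S : lmodType K) (br : S -> S -> S).
Variables (gr : Gam * A -> set S).
Hypotheses (brl : forall v, linear (br^~ v)) (brr : forall u, linear (br u)).
Hypothesis gr_closed : forall p, submod_closed [in gr p].
Hypothesis gr_free : forall (s : seq (Gam * A)) (w : Gam * A -> S), uniq s ->
  (forall p, gr p (w p)) -> \sum_(p <- s) w p = 0 -> forall p, p \in s -> w p = 0.
Hypothesis gr_br : graded_bracket gr br.
Hypothesis gr_antisym : forall p q u v, gr p u -> gr q v ->
  br u v = - (theta p.2 q.2 *: br v u).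
Hypothesis gr_jacobi : forall p q r u v w, gr p u -> gr q v -> gr r w ->
  br u (br v w) = br (br u v) w + theta p.2 q.2 *: br v (br u w).

(** The pieces [gr p] are independent but need not span [S]; they grade their sum. This serves both
    the subalgebra generated by the letters and the target in the free associative algebra. *)
Inductive hsum : S -> Prop :=
| hsum_gr p u : gr p u -> hsum u
| hsum0 : hsum 0
| hsum_linear c u v : hsum u -> hsum v -> hsum (c *: u + v).

Lemma gr0 p : gr p 0.
Proof. by have [/set_mem] := gr_closed p. Qed.

Lemma gr_linear p c u v : gr p u -> gr p v -> gr p (c *: u + v).
Proof.
move=> pu pv; have [_ H] := gr_closed p.
by apply/set_mem; apply: H; apply/mem_set.
Qed.

Lemma hsum_decomp u : hsum u -> exists (s : seq (Gam * A)) (w : Gam * A -> S),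
  [/\ uniq s, forall p, gr p (w p), forall p, p \notin s -> w p = 0
    & u = \sum_(p <- s) w p].
Proof.
elim => {u} [p u pu||c u v _ [s [w [us ws w0 uE]]] _ [t [x [ut xt x0 vE]]]].
- exists [:: p], (fun q => if q == p then u else 0); split => //.
  + by move=> q; case: eqP => [->|_] //; apply: gr0.
  + by move=> q; rewrite inE => /negPf ->.
  + by rewrite big_seq1 eqxx.
- by exists [::], (fun=> 0); split => //; [move=> p; apply: gr0|rewrite big_nil].
have ext s' w' : uniq s' -> {subset s' <= undup (s ++ t)} ->
    (forall p, p \notin s' -> w' p = 0) ->
    \sum_(p <- s') w' p = \sum_(p <- undup (s ++ t)) w' p :> S.
  move=> us' sub w'0; rewrite [RHS](bigID (mem s')) /= [X in _ + X]big1 ?addr0; last first.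
    by move=> p /w'0.
  rewrite -[RHS]big_filter; apply: perm_big; apply: uniq_perm => //.
    by rewrite filter_uniq ?undup_uniq.
  move=> p; rewrite mem_filter /=; case: (boolP (p \in s')) => //= /sub ->.
  by [].
exists (undup (s ++ t)), (fun p => c *: w p + x p); split.
- exact: undup_uniq.
- by move=> p; apply: gr_linear.
- move=> p; rewrite mem_undup mem_cat negb_or => /andP[/w0 -> /x0 ->].
  by rewrite scaler0 addr0.
- rewrite big_split -scaler_sumr uE vE; congr (_ *: _ + _); apply: ext => //.
    by move=> p ps; rewrite mem_undup mem_cat ps.
  by move=> p pt; rewrite mem_undup mem_cat pt orbT.
Qed.

Lemma hsum_br u v : hsum u -> hsum v -> hsum (br u v).
Proof.
elim => {u} [p u pu||c u u' _ IHu _ IHu'] Hv.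
- elim: Hv => {v} [q v qv||c v v' _ Hv _ Hv'].
  + exact: hsum_gr (gr_br pu qv).
  + by rewrite (linear_at0 (brr u)); apply: hsum0.
  + by rewrite brr; apply: hsum_linear.
- by have /= -> := linear_at0 (brl v); apply: hsum0.
- by have /= -> := brl v c u u'; apply: hsum_linear; [apply: IHu|apply: IHu'].
Qed.

Definition hsum_pred : {pred S} := fun u => `[< hsum u >].

Lemma hsum_closed : submod_closed hsum_pred.
Proof.
split; first by apply/asboolP; apply: hsum0.
move=> c u v /asboolP Hu /asboolP Hv.
by apply/asboolP; apply: hsum_linear.
Qed.

Definition hsum_space := Subspace hsum_closed.
Definition hsum_alg := subspace_sort hsum_space.
HB.instance Definition _ := GRing.Lmodule.on hsum_alg.

Lemma hsum_valP (x : hsum_alg) : hsum (val x).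
Proof. by apply/asboolP; apply: (valP x). Qed.

Definition hsum_in u (Hu : hsum u) : hsum_alg :=
  @SubspaceSort _ _ hsum_space u (introT (asboolP _) Hu).

Definition hsum_bracket (x y : hsum_alg) : hsum_alg :=
  hsum_in (hsum_br (hsum_valP x) (hsum_valP y)).

Definition hsum_gr' p : set hsum_alg := [set x | gr p (val x)].

Lemma hsum_color : color_lie_superalgebra theta hsum_gr' hsum_bracket.
Proof.
have lin_val c (x y : hsum_alg) : val (c *: x + y) = c *: val x + val y by [].
have val0 : val (0 : hsum_alg) = 0 by [].
have val_sum (T : Type) (s : seq T) (F : T -> hsum_alg) :
    val (\sum_(t <- s) F t) = \sum_(t <- s) val (F t).
  by elim/big_rec2: _ => // i a b _ <-.
split.
- split.
  + move=> p; split; first by apply/mem_set; apply: gr0.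
    move=> c x y /set_mem px /set_mem py; apply/mem_set.
    exact: gr_linear.
  + move=> x; have [s [w [_ ws _ xE]]] := hsum_decomp (hsum_valP x).
    exists s, (fun p => hsum_in (hsum_gr (ws p))); split=> //.
    by apply: val_inj; rewrite val_sum.
  + move=> s w us ws sum0 p ps; apply: val_inj; rewrite val0.
    by apply: (gr_free us ws _ ps); rewrite -val_sum sum0.
- by move=> y c x x'; apply: val_inj; rewrite lin_val /=; apply: (brl (val y)).
- by move=> x c y y'; apply: val_inj; rewrite lin_val /=; apply: brr.
- by move=> p q x y px qy; apply: gr_br.
- move=> al a be b x y px qy; apply: val_inj => /=.
  exact: (gr_antisym px qy).
- move=> al a be b x y z px qy; apply: val_inj => /=.
  (* The assumed Jacobi identity has a homogeneous third argument; linearity extends it to arbitrary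
     ones. *)
  elim: (hsum_valP z) => {z} [r w rw||c u v _ Hu _ Hv].
  + exact: (gr_jacobi px qy rw).
  + have := linear_at0 (brr _) => br0.
    by rewrite !br0 scaler0 addr0.
  + rewrite !brr Hu Hv !scalerDr !scalerA [_ * c]mulrC.
    by rewrite addrACA.
Qed.

End SumOfHomogeneous.

(** * Homogeneous bases triangularizing an endomorphism *)

Lemma sum_fibers (T U : eqType) (M : nmodType) (s : seq T) (h : T -> U)
    (F : T -> M) :
  \sum_(t <- s) F t = \sum_(u <- undup [seq h t | t <- s]) \sum_(t <- s | h t == u) F t.
Proof.
under [RHS]eq_bigr do rewrite big_mkcond.
rewrite exchange_big /= big_seq [RHS]big_seq; apply: eq_bigr => t ts.
rewrite (bigD1_seq (h t)) ?undup_uniq ?mem_undup ?map_f //= eqxx big1 ?addr0 //.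
by move=> u /negPf; rewrite eq_sym => ->.
Qed.

Section TriangularBasis.
Variables (C : numClosedFieldType) (V : lmodType C).

(** Row [i] of [T] holds the coordinates of [f (b i)], so a lower triangular [T] keeps [f (b i)] in
    the span of the [b j] with j at most i, and the index can serve as height. *)
Lemma triangular_basis (W : set V) (f : V -> V) : linear f -> finite_dim W ->
  (forall v, W v -> W (f v)) ->
  exists (n : nat) (b : 'I_n -> V) (T : 'M[C]_n),
    [/\ is_basis W b, forall i j : 'I_n, (i < j)%N -> T i j = 0
      & forall i, f (b i) = \sum_j T i j *: b j].
Proof.
move=> linf [n [b [WE bfree]]] fW.
pose fl : {linear V -> V} := HB.pack f (GRing.isLinear.Build _ _ _ _ f linf).
have f0 : f 0 = 0 := raddf0 fl.
have fsum (c : 'I_n -> C) (e : 'I_n -> V) :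
    f (\sum_i c i *: e i) = \sum_i c i *: f (e i).
  rewrite -[f]/(fl : V -> V) raddf_sum; apply: eq_bigr => i _ /=.
  by rewrite -[_ *: _]addr0 linf f0 addr0.
have /choice[N NP] : forall j, exists c : 'I_n -> C, f (b j) = \sum_i c i *: b i.
  move=> j; have : W (f (b j)).
    apply: fW; rewrite WE; exists (fun k => (k == j)%:R).
    rewrite (bigD1 j) //= eqxx scale1r big1 ?addr0 // => k /negPf ->.
    by rewrite scale0r.
  by rewrite {1}WE.
pose M : 'M[C]_n := \matrix_(j, i) N j i.
have comm : {in [:: M] &, forall A B, comm_mx A B}.
  by move=> A B; rewrite !inE => /eqP -> /eqP ->.
have [P Punit] := cotrigonalization comm.
rewrite /= andbT => Ptri.
have Pu : P \in unitmx := unitarymx_unit Punit.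
pose T := P *m M *m invmx P.
have TP : T *m P = P *m M by rewrite mulmxKV.
pose b' k := \sum_j P k j *: b j.
have sumb' (c : 'I_n -> C) :
    \sum_k c k *: b' k = \sum_j (\row_k c k *m P) 0 j *: b j.
  rewrite /b'; under eq_bigr do rewrite scaler_sumr.
  rewrite exchange_big; apply: eq_bigr => j _; rewrite mxE scaler_suml.
  by apply: eq_bigr => k _; rewrite scalerA mxE.
exists n, b', T; split.
- split.
    rewrite WE eqEsubset; split=> v [c ->].
      exists (fun k => (\row_i c i *m invmx P) 0 k); rewrite sumb'.
      have -> : \row_k (\row_i c i *m invmx P) 0 k = \row_i c i *m invmx P.
        by apply/rowP => k; rewrite mxE.
      by apply: eq_bigr => j _; rewrite mulmxKV // mxE.
    by rewrite sumb'; exists (fun j => (\row_k c k *m P) 0 j).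
  move=> c; rewrite sumb' => /bfree c0 i.
  have /rowP/(_ i) : \row_k c k = 0.
    rewrite -[LHS](mulmxK Pu).
    have -> : \row_k c k *m P = 0 by apply/rowP => j; rewrite c0 mxE.
    by rewrite mul0mx.
  by rewrite !mxE.
- move=> i j ij; move: Ptri; rewrite /similar_to conjumx //.
  by move=> /is_trig_mxP /(_ _ _ ij).
- move=> i; rewrite sumb' fsum.
  have -> : \row_k T i k = row i T by apply/rowP => k; rewrite !mxE.
  rewrite -row_mul TP; under eq_bigr do rewrite NP scaler_sumr.
  rewrite exchange_big; apply: eq_bigr => j _; rewrite !mxE scaler_suml.
  by apply: eq_bigr => k _; rewrite scalerA mxE.
Qed.

End TriangularBasis.

Section HomogeneousBasis.
Variables (K : fieldType) (V : lmodType K) (X : choiceType) (e : X -> V).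

(* Linear combinations are lists of pairs (coefficient, index), in which an
   index may be repeated. *)
Definition comb (M : lmodType K) (m : X -> M) (s : seq (K * X)) : M :=
  \sum_(t <- s) t.1 *: m t.2.

Definition hamel_free : Prop := forall (s : seq X) (c : X -> K), uniq s ->
  \sum_(x <- s) c x *: e x = 0 -> forall x, x \in s -> c x = 0.

Lemma comb_eq0 (M : lmodType K) (m : X -> M) s :
  hamel_free -> comb e s = 0 -> comb m s = 0.
Proof.
move=> efree.
have combE (M' : lmodType K) (m' : X -> M') : comb m' s =
    \sum_(x <- undup [seq t.2 | t <- s]) (\sum_(t <- s | t.2 == x) t.1) *: m' x.
  rewrite /comb (sum_fibers _ (fun t => t.2)); apply: eq_bigr => x _.
  by rewrite scaler_suml; apply: eq_bigr => t /eqP ->.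
rewrite !combE => /efree c0; rewrite big_seq big1 // => x xs.
by rewrite c0 ?undup_uniq ?scale0r.
Qed.

(** The chosen expression of each vector is arbitrary; by [comb_eq0] its value is independent of the
    choice, which gives linearity. *)
Lemma linear_extension (M : lmodType K) (m : X -> M) : hamel_free ->
  (forall v, exists s, v = comb e s) ->
  exists f : V -> M, linear f /\ forall x, f (e x) = m x.
Proof.
move=> efree /choice[r rP]; exists (fun v => comb m (r v)).
have comb_cat (M' : lmodType K) (m' : X -> M') s t :
  comb m' (s ++ t) = comb m' s + comb m' t by apply: big_cat.
have combZ (M' : lmodType K) (m' : X -> M') c s :
    comb m' [seq (c * t.1, t.2) | t <- s] = c *: comb m' s.
  by rewrite /comb big_map scaler_sumr; apply: eq_bigr => t _; rewrite scalerA.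
split.
  move=> c u v; apply/eqP; rewrite -subr_eq0 opprD addrA; apply/eqP.
  have := @comb_eq0 M m (r (c *: u + v) ++
    [seq (- c * t.1, t.2) | t <- r u] ++ [seq (- 1 * t.1, t.2) | t <- r v]) efree.
  rewrite !comb_cat !combZ -!rP !scaleNr !scale1r !addrA; apply.
  by rewrite [_ + v]addrC addrK subrr.
move=> x; have := @comb_eq0 M m (r (e x) ++ [:: (- 1, x)]) efree.
rewrite !comb_cat -rP /comb !big_seq1 /= !scaleN1r subrr => /(_ erefl) /eqP.
by rewrite subr_eq0 => /eqP.
Qed.

End HomogeneousBasis.

Section GradedTriangularBasis.
Variables (C : numClosedFieldType) (V : lmodType C) (I : choiceType).
Variables (gr : I -> set V) (f : V -> V).
Hypotheses (Hgr : grading gr) (fin : forall p, finite_dim (gr p)).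
Hypotheses (linf : linear f) (fgr : forall p v, gr p v -> gr p (f v)).

Lemma graded_triangular_basis :
  exists (X : choiceType) (ix : X -> I) (lam : X -> C) (ht : X -> nat)
    (e : X -> V),
  [/\ forall p, exists s : seq X, forall x, ix x = p -> x \in s,
      forall x, gr (ix x) (e x),
      forall x, exists s, f (e x) - lam x *: e x = comb e s /\
        forall t, t \in s -> ix t.2 = ix x /\ (ht t.2 < ht x)%N,
      forall p v, gr p v -> exists s, v = comb e s /\
        forall t, t \in s -> ix t.2 = p
    & hamel_free e].
Proof.
pose Hn p := cid (triangular_basis linf (fin p) (@fgr p)).
pose Hb p := cid (svalP (Hn p)); pose HT p := cid (svalP (Hb p)).
pose n p := sval (Hn p); pose b p : 'I_(n p) -> V := sval (Hb p).
pose T p : 'M[C]_(n p) := sval (HT p).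
have bP p : [/\ is_basis (gr p) (b p),
    forall i j : 'I_(n p), (i < j)%N -> T p i j = 0
  & forall i, f (b p i) = \sum_j T p i j *: b p j] := svalP (HT p).
clearbody T b; move: n T b bP; move=> n T b bP {HT Hb Hn}.
(* A letter is a degree with a position in the basis of that component; the diagonal entry is its
   eigenvalue. *)
exists {p : I & 'I_(n p)}, (@tag _ _), (fun x => T (tag x) (tagged x) (tagged x)).
exists (fun x : {p : I & 'I_(n p)} => nat_of_ord (tagged x)), (fun x => b (tag x) (tagged x)).
have gr_b p i : gr p (b p i).
  have [[-> _] _ _] := bP p; exists (fun k => (k == i)%:R).
  rewrite (bigD1 i) //= eqxx scale1r big1 ?addr0 // => k /negPf ->.
  by rewrite scale0r.
have grZD p c u v : gr p u -> gr p v -> gr p (c *: u + v).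
  move=> pu pv; have [_ H] := grading_subspace Hgr p.
  by apply/set_mem; apply: H; apply/mem_set.
have gr0' p : gr p 0 by have [/set_mem] := grading_subspace Hgr p.
split.
- move=> p; exists [seq Tagged (fun p => 'I_(n p)) i | i <- enum 'I_(n p)].
  by case=> q i /= qp; subst q; apply/map_f; rewrite mem_enum.
- by move=> x; apply: gr_b.
- case=> p i /=; have [_ Ttri fb] := bP p.
  exists [seq (T p i j, Tagged (fun p => 'I_(n p)) j) | j : 'I_(n p) <- enum 'I_(n p) & (j < i)%N].
  split; last by move=> t /mapP[j]; rewrite mem_filter => /andP[ji _] ->.
  rewrite /comb big_map big_filter big_enum_cond /= fb (bigD1 i) //= [LHS]addrC addKr.
  rewrite (bigID (fun j : 'I_(n p) => (j < i)%N)) /= [X in _ + X]big1 ?addr0.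
    by apply: eq_bigl => j; rewrite andbC; case: ltnP => // ji; rewrite -(inj_eq val_inj) neq_ltn ji.
  move=> j /andP[ji]; rewrite -leqNgt leq_eqVlt (inj_eq val_inj) eq_sym (negPf ji) /= => ij.
  by rewrite Ttri ?scale0r.
- move=> p v; have [[-> _] _ _] := bP p; case=> c ->.
  exists [seq (c j, Tagged (fun p => 'I_(n p)) j) | j <- enum 'I_(n p)].
  split; last by move=> t /mapP[j _ ->].
  by rewrite /comb big_map big_enum.
- move=> s c us sum0.
  pose w p := \sum_(x <- s | tag x == p) c x *: b (tag x) (tagged x).
  have w_gr p : gr p (w p).
    rewrite /w big_mkcond; elim: s {us sum0 w} => [|x s IH]; first by rewrite big_nil.
    rewrite big_cons /=; case: eqP => [xp|_]; last by rewrite add0r.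
    by apply: grZD => //; rewrite -xp.
  case=> p i xs; have wp0 : w p = 0.
    apply: (grading_free Hgr (undup_uniq [seq tag x | x <- s]) w_gr).
      by rewrite -sum_fibers.
    by rewrite mem_undup; apply/mapP; exists (Tagged (fun p => 'I_(n p)) i).
  have [[_ bfree] _ _] := bP p.
  pose c' (j : 'I_(n p)) := if Tagged (fun p => 'I_(n p)) j \in s
    then c (Tagged (fun p => 'I_(n p)) j) else 0.
  suff /bfree/(_ i) : \sum_j c' j *: b p j = 0 by rewrite /c' xs.
  rewrite -[RHS]wp0 /w.
  transitivity (\sum_(x <- [seq Tagged (fun p => 'I_(n p)) j | j <- enum 'I_(n p)]
      | x \in s) c x *: b (tag x) (tagged x)).
    rewrite big_map big_enum_cond [RHS]big_mkcond; apply: eq_bigr => j _ /=.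
    by rewrite /c'; case: ifP => // _; rewrite scale0r.
  rewrite -big_filter -[RHS]big_filter; apply: perm_big; apply: uniq_perm.
  + rewrite filter_uniq // map_inj_uniq ?enum_uniq //.
    by move=> j k /eqP; rewrite eq_Tagged => /eqP.
  + exact: filter_uniq.
  + case=> q j; rewrite !mem_filter andbC; case: (boolP (_ \in s)); rewrite ?andbF //.
    rewrite !andbT => _; apply/mapP/eqP => [[k _ /(congr1 tag)] //|/= qp].
    by subst q; exists j; rewrite ?mem_enum.
Qed.

End GradedTriangularBasis.

(** * The free associative algebra as a color Lie superalgebra *)

Section LinearExtension.
Variables (K : fieldType) (Y : choiceType) (B : algType K).
Implicit Types (h : word Y -> B) (p q : free_alg K Y).

Definition lext h p : B := mmap (in_alg B) h p.

Lemma lextE h p : lext h p = \sum_(w <- finmap.enum_fset (msupp p)) p@_w *: h w.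
Proof. by rewrite /lext mmapE; apply: eq_bigr => w _; rewrite /= mulr_algl. Qed.

Lemma lext_linear h : linear (lext h).
Proof.
move=> c p q; rewrite /lext raddfD /= (mmapEw (msuppZ_le c p)) (mmapE _ _ p) scaler_sumr.
by congr (_ + _); apply: eq_bigr => w _; rewrite mcoeffZ /= !mulr_algl scalerA.
Qed.

Lemma lext_linear_fun c h h' p :
  lext (fun w => c *: h w + h' w) p = c *: lext h p + lext h' p.
Proof.
rewrite !lextE scaler_sumr -big_split; apply: eq_bigr => w _ /=.
by rewrite scalerDr !scalerA mulrC.
Qed.

End LinearExtension.

Section ColorOf.
Variables (Gam : addSemigroupType) (A : zmodType).

Definition color_of (o : adjoin0 (Gam * A)%type) : A :=
  if o is Some p then p.2 else 0.

Lemma color_ofD o o' : color_of (o + o') = color_of o + color_of o'.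
Proof. by case: o o' => [p|] [q|] //=; rewrite ?addr0 ?add0r. Qed.

End ColorOf.

(** The scalars [ab], [ba], [ac], [bc] are the values of the coloring on the degrees a, b, c of [f],
    [g], [h]. *)
Lemma color_jacobi_identity (K : fieldType) (B : algType K) (f g h : B)
    (ab ba ac bc : K) : ab * ba = 1 ->
  f * (g * h - bc *: (h * g)) - (ab * ac) *: ((g * h - bc *: (h * g)) * f) =
  (f * g - ab *: (g * f)) * h - (ac * bc) *: (h * (f * g - ab *: (g * f))) +
    ab *: (g * (f * h - ac *: (h * f)) - (ba * bc) *: ((f * h - ac *: (h * f)) * g)).
Proof.
move=> E; rewrite !mulrBl !mulrBr !scalerBr -!scalerAl -!scalerAr !scalerA !mulrA.
have -> : ab * ba * bc * ac = ac * bc by rewrite E; ring.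
have -> : ac * bc * ab = ab * ac * bc by ring.
rewrite E mul1r !opprB [RHS]addrACA ![in RHS]addrA subrK.
rewrite -[X in _ = X]addrA addrACA subrK addrACA [LHS]addrACA.
by rewrite [RHS]addrACA; congr (_ + _); rewrite addrC.
Qed.

Section ColorFreeAlgebra.
Variables (K : fieldType) (A : zmodType) (theta : A -> A -> K).
Hypothesis Htheta : coloring_map theta.
Variables (Gam : addSemigroupType) (X : choiceType) (ix : X -> Gam * A).

Notation T := (free_alg K X).
Implicit Types f g h : T.

Definition word_idx (w : word X) : adjoin0 (Gam * A)%type :=
  \sum_(i <- w) (Some (ix i) : adjoin0 (Gam * A)%type).

Lemma word_idx_cat u v : word_idx (u ++ v) = word_idx u + word_idx v.
Proof. exact: big_cat. Qed.

Definition word_degree (o : adjoin0 (Gam * A)%type) : set T :=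
  supported (fun w => word_idx w = o).

Definition homog (p : Gam * A) : set T := word_degree (Some p).

(** Twisting word by word gives a bilinear operation on the whole algebra, which on homogeneous
    elements is the reversed product scaled by theta. *)
Definition twisted_mul f g : T :=
  lext (fun u => lext (fun v =>
    theta (color_of (word_idx u)) (color_of (word_idx v)) *:
    (<< (v ++ u : word X) >> : T)) g) f.

Definition color_commutator f g : T := f * g - twisted_mul f g.

Lemma color_commutator_linearl g : linear (color_commutator^~ g).
Proof.
move=> c f f'; rewrite /color_commutator /twisted_mul lext_linear.
by rewrite mulrDl -scalerAl scalerBr opprD addrACA.
Qed.

Lemma color_commutator_linearr f : linear (color_commutator f).
Proof.
move=> c g g'; rewrite /color_commutator.
have -> : twisted_mul f (c *: g + g') = c *: twisted_mul f g + twisted_mul f g'.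
  rewrite /twisted_mul -lext_linear_fun; congr (lext _ f).
  by apply/funext => u; rewrite lext_linear.
by rewrite mulrDr -scalerAr scalerBr opprD addrACA.
Qed.

Lemma color_commutatorE o o' f g : word_degree o f -> word_degree o' g ->
  color_commutator f g = f * g - theta (color_of o) (color_of o') *: (g * f).
Proof.
move=> fo go'; congr (_ - _); rewrite /twisted_mul lextE malgME exchange_big.
rewrite scaler_sumr /= big_seq [RHS]big_seq; apply: eq_bigr => u uf.
rewrite lextE !scaler_sumr big_seq [RHS]big_seq; apply: eq_bigr => v vg.
rewrite (fo u) ?mcoeff_neq0 // (go' v) ?mcoeff_neq0 // !scalerA.
apply/malgP => w; rewrite !mcoeffZ !mcoeffU !mulrnAr mulr1.
by congr (_ *+ _); ring.
Qed.

Lemma word_degreeM o o' f g :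
  word_degree o f -> word_degree o' g -> word_degree (o + o') (f * g).
Proof. by apply: supportedM => u v uo vo; rewrite word_idx_cat uo vo. Qed.

Lemma word_degree_commutator o o' f g : word_degree o f -> word_degree o' g ->
  word_degree (o + o') (color_commutator f g).
Proof.
move=> fo go; rewrite (color_commutatorE fo go); apply: supportedB.
  exact: word_degreeM.
by apply: supportedZ; rewrite addrC; apply: word_degreeM.
Qed.

Lemma homog_closed p : submod_closed [in homog p].
Proof.
split; first by apply/mem_set; apply: supported0.
move=> c f g /set_mem fp /set_mem gp; apply/mem_set.
by apply: supportedD => //; apply: supportedZ.
Qed.

Lemma homog_free (s : seq (Gam * A)) (w : Gam * A -> T) : uniq s ->
  (forall p, homog p (w p)) -> \sum_(p <- s) w p = 0 ->
  forall p, p \in s -> w p = 0.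
Proof.
move=> us ws sum0 p ps; apply/malgP => k; rewrite mcoeff0.
apply/eqP/negPn/negP => wk; have kp := ws _ _ wk.
have := congr1 (mcoeff k) sum0; rewrite mcoeff0 raddf_sum (bigD1_seq p) //=.
rewrite big1 => [|q qp]; first by rewrite addr0 => /eqP; rewrite (negPf wk).
apply/eqP/negPn/negP => /ws; rewrite kp => -[pq].
by rewrite pq eqxx in qp.
Qed.

Lemma homog_commutator : graded_bracket homog color_commutator.
Proof. by move=> p q f g fp gq; apply: (word_degree_commutator fp gq). Qed.

Lemma commutator_antisym p q f g : homog p f -> homog q g ->
  color_commutator f g = - (theta p.2 q.2 *: color_commutator g f).
Proof.
move=> fp gq; rewrite (color_commutatorE fp gq) (color_commutatorE gq fp) /=.
by rewrite scalerBr scalerA (coloringC Htheta) scale1r opprB.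
Qed.

Lemma commutator_jacobi p q r f g h : homog p f -> homog q g -> homog r h ->
  color_commutator f (color_commutator g h) =
  color_commutator (color_commutator f g) h +
    theta p.2 q.2 *: color_commutator g (color_commutator f h).
Proof.
move=> fp gq hr.
have fg := word_degree_commutator fp gq; have gh := word_degree_commutator gq hr.
have fh := word_degree_commutator fp hr.
rewrite (color_commutatorE fp gh) (color_commutatorE fg hr) (color_commutatorE gq fh).
rewrite (color_commutatorE fp gq) (color_commutatorE gq hr) (color_commutatorE fp hr) /=.
rewrite !(coloringDl Htheta) !(coloringDr Htheta).
have E := coloringC Htheta p.2 q.2.
exact: color_jacobi_identity.
Qed.

(* Since word_idx is None on the empty word, the sum of the homogeneous parts is
   the augmentation ideal, which is graded by the semigroup itself. *)
Definition free_color_alg := hsum_alg homog.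
HB.instance Definition _ := GRing.Lmodule.on free_color_alg.

Definition free_color_gr : Gam * A -> set free_color_alg := hsum_gr' (gr:=homog).

Definition free_color_br : free_color_alg -> free_color_alg -> free_color_alg :=
  hsum_bracket color_commutator_linearl color_commutator_linearr homog_commutator.

Lemma free_color_algP : color_lie_superalgebra theta free_color_gr free_color_br.
Proof.
apply: hsum_color; [exact: homog_closed|exact: homog_free
  |exact: commutator_antisym|exact: commutator_jacobi].
Qed.

Lemma homog_letter x : homog (ix x) (letter x).
Proof. by apply: supported_word; rewrite /word_idx big_seq1. Qed.

Definition free_color_letter x : free_color_alg :=
  hsum_in (hsum_gr (@homog_letter x)).

Section Hom.
Variables (J : nmodType) (S : lmodType K) (br : S -> S -> S).
Variables (deg : X -> J) (y : X -> S) (idxJ : J -> adjoin0 (Gam * A)%type).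
Hypotheses (idxJD : forall d e, idxJ (d + e) = idxJ d + idxJ e)
  (idx_deg : forall x, idxJ (deg x) = Some (ix x)).
Variable F : S -> free_color_alg.
Hypotheses (homF : bracket_hom br free_color_br F)
  (F_letter : forall x, F (y x) = free_color_letter x).

Lemma hom_word_degree d u : lie_span br deg y d u ->
  word_degree (idxJ d) (val (F u)).
Proof.
have F0 : F 0 = 0.
  by have := homF.1 (-1) 0 0; rewrite scaler0 addr0 scaleN1r addNr.
elim => {d u} [x|d|d c u v _ Hu _ Hv|d e u v _ Hu _ Hv].
- by rewrite idx_deg F_letter; apply: homog_letter.
- by rewrite F0; apply: supported0.
- by rewrite homF.1; apply: supportedD => //; apply: supportedZ.
- by rewrite homF.2 idxJD; apply: word_degree_commutator.
Qed.

Lemma hom_commutator d e u v :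
  lie_span br deg y d u -> lie_span br deg y e v ->
  val (F (br u v)) = val (F u) * val (F v) -
    theta (color_of (idxJ d)) (color_of (idxJ e)) *: (val (F v) * val (F u)).
Proof.
move=> /hom_word_degree Fu /hom_word_degree Fv.
by rewrite homF.2 -(color_commutatorE Fu Fv).
Qed.

Lemma hom_eval_inj (p : T) : eval ((fun u => val (F u)) \o y) p = 0 -> p = 0.
Proof.
have -> : (fun u => val (F u)) \o y = letter.
  by apply/funext => x /=; rewrite F_letter.
suff -> : eval letter p = p by [].
rewrite [p in RHS]monalgE /eval mmapE; apply: eq_bigr => w _.
have -> : evalw letter w = << w >> :> T.
  elim: w => [|x w IH]; first by rewrite /evalw big_nil.
  by rewrite /evalw big_cons -/(evalw _ _) IH malgM_def fgmulUU mulr1.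
by rewrite /= mulr_algl; apply/malgP => k; rewrite mcoeffZ !mcoeffU mulrnAr mulr1.
Qed.

End Hom.
End ColorFreeAlgebra.

(** * Traces on homogeneous components *)

Section TraceFormula.
Variables (K : fieldType) (A : zmodType) (theta : A -> A -> K).
Hypothesis Htheta : coloring_map theta.
Variables (Gam : addSemigroupType).

Notation I := (Gam * A)%type.
Notation J := (degree I K).

Definition degree_factor (d e : J) : K :=
  theta (color_of (idx d)) (color_of (idx e)).

Lemma degree_factor_bicharacter : bicharacter degree_factor.
Proof.
split=> [a b c|a b c|a b]; rewrite /degree_factor ?idxD ?color_ofD.
- exact: coloringDl.
- exact: coloringDr.
- exact: coloringC.
Qed.

Variables (S : lmodType K) (gr : I -> set S) (br : S -> S -> S).
Hypothesis Hcolor : color_lie_superalgebra theta gr br.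

Let brl := color_linearl Hcolor.
Let brr := color_linearr Hcolor.
Let Hgr := color_grading Hcolor.

Let br0l v : br 0 v = 0. Proof. exact: (linear_at0 (brl v)). Qed.
Let br0r v : br v 0 = 0. Proof. exact: (linear_at0 (brr v)). Qed.

Lemma grading0 p : gr p 0.
Proof. by have [/set_mem] := grading_subspace Hgr p. Qed.

Lemma grading_linear p c u v : gr p u -> gr p v -> gr p (c *: u + v).
Proof.
move=> pu pv; have [_ H] := grading_subspace Hgr p.
by apply/set_mem; apply: H; apply/mem_set.
Qed.

(** Eigenvalue and height are ignored, so many degrees share one space; hence [color_bracket] asks
    for no direct sum. *)
Definition degree_space (d : J) : set S :=
  if idx d is Some p then gr p else [set 0].

Lemma degree_space_color_bracket :
  color_bracket degree_factor degree_space br.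
Proof.
split=> //.
- move=> d c u v; rewrite /degree_space; case: (idx d) => [p|/= -> ->].
    exact: grading_linear.
  by rewrite scaler0 addr0.
- by move=> d; rewrite /degree_space; case: (idx d) => [p|//]; apply: grading0.
- move=> d e u v; rewrite /degree_space idxD.
  case: (idx d) (idx e) => [p|] [q|] //=; rewrite ?br0l ?br0r.
  + exact: (color_graded Hcolor).
  + by move=> _ ->; rewrite br0r; apply: grading0.
  + by move=> -> _; rewrite br0l; apply: grading0.
  + by move=> -> _; rewrite br0l.
- move=> d e u v; rewrite /degree_space /degree_factor.
  case: (idx d) (idx e) => [[al a]|] [[be b]|] /=.
  + exact: (color_antisym Hcolor).
  + by move=> _ ->; rewrite br0l br0r scaler0 oppr0.
  + by move=> -> _; rewrite br0l br0r scaler0 oppr0.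
  + by move=> -> _; rewrite br0l br0r scaler0 oppr0.
- move=> d e u v w; rewrite /degree_space /degree_factor.
  case: (idx d) (idx e) => [[al a]|] [[be b]|] /=.
  + exact: (color_jacobi Hcolor).
  + by move=> _ ->; rewrite !br0l br0r br0l scaler0 addr0.
  + by move=> -> _; rewrite !br0l br0r scaler0 addr0.
  + by move=> -> _; rewrite !br0l br0r scaler0 addr0.
Qed.

Variables (X : choiceType) (ix : X -> I) (deg : X -> J) (y : X -> S).
Hypotheses (idx_deg : forall x, idx (deg x) = Some (ix x))
  (y_gr : forall x, gr (ix x) (y x)).

Lemma letters_degree_space x : degree_space (deg x) (y x).
Proof. by rewrite /degree_space idx_deg. Qed.

Let lie_span_gr d u : lie_span br deg y d u -> degree_space d u.
Proof. exact: (lie_span_H degree_space_color_bracket letters_degree_space). Qed.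

Definition homogeneous_part (p : I) : set S :=
  lie_closure br deg y [set d | idx d = Some p].

Lemma homogeneous_part_closed p : submod_closed [in homogeneous_part p].
Proof.
split; first by apply/mem_set; apply: lie_closure0.
move=> c u v /set_mem pu /set_mem pv; apply/mem_set.
exact: lie_closure_linear.
Qed.

Lemma homogeneous_part_sub p : homogeneous_part p `<=` gr p.
Proof.
move=> u; elim => {u} [d u /= dp /lie_span_gr||c u v _ Hu _ Hv].
- by rewrite /degree_space dp.
- exact: grading0.
- exact: grading_linear.
Qed.

Lemma homogeneous_part_br : graded_bracket homogeneous_part br.
Proof.
by move=> p q u v; apply: lie_closure_br => // d e /= dp eq; rewrite idxD dp eq.
Qed.

Lemma lie_closure_hsum D u : lie_closure br deg y D u -> hsum homogeneous_part u.
Proof.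
elim => {u} [d u _ du||c u v _ Hu _ Hv].
- have := lie_span_gr du; rewrite /degree_space; case E: (idx d) => [p|].
    by move=> _; apply: (@hsum_gr _ _ _ _ _ p); apply: lie_closure_span du.
  by move=> ->; apply: hsum0.
- exact: hsum0.
- exact: hsum_linear.
Qed.

Hypothesis generated : forall u, lie_closure br deg y setT u.

(** Generation only gives a sum of generated homogeneous parts; freeness of the grading identifies
    [u] with the part of degree [p]. *)
Lemma homogeneous_partE p u : gr p u -> homogeneous_part p u.
Proof.
move=> pu; have [s [w [us ws w0 uE]]] :=
  hsum_decomp homogeneous_part_closed (lie_closure_hsum (generated u)).
suff -> : u = w p by apply: ws.
pose w' q := w q - (if q == p then u else 0).
have w'_gr q : gr q (w' q).
  rewrite /w' -scaleN1r addrC; apply: grading_linear.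
    by case: eqP => [->|_] //; apply: grading0.
  exact/homogeneous_part_sub/ws.
have ps : p \in undup (p :: s) by rewrite mem_undup inE eqxx.
suff sum0 : \sum_(q <- undup (p :: s)) w' q = 0.
  have := grading_free Hgr (undup_uniq _) w'_gr sum0 ps.
  by rewrite /w' eqxx => /eqP; rewrite subr_eq0 => /eqP.
rewrite sumrB [X in _ - X](bigD1_seq p) ?undup_uniq //= eqxx.
rewrite [X in _ - (_ + X)]big1 ?addr0 => [|q /negPf -> //].
apply/eqP; rewrite subr_eq0 {1}uE eq_sym; apply/eqP.
rewrite /=; case: ifP => ps'; rewrite undup_id //.
by rewrite big_cons w0 ?add0r // ps'.
Qed.

Variables (tgt : set J) (ls : seq J) (bs : seq (J * S)).
Hypothesis Hbs : lie_basis tgt degree_factor deg ls br y bs.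
Variable F : S -> free_color_alg K ix.
Hypotheses (homF : bracket_hom br (free_color_br theta (ix:=ix)) F)
  (F_letter : forall x, F (y x) = free_color_letter K ix x).

(** The elimination basis, restricted to index [p] alone, collects all eigenvalues and heights
    occurring there, and [f] is triangular on it with respect to height. *)
Theorem trace_on_degree (p : I) (f : S -> S) (lam : J -> K) :
  (forall d, idx d = Some p -> tgt d) ->
  linear f -> triangular br deg y f lam ->
  trace_on f (gr p) = \sum_(d <- with_squares degree_factor ls | idx d == Some p) lam d.
Proof.
move=> p_tgt linf ftri; have [bs_deg bs_in bs_span bs_indep] := Hbs.
pose es := [seq e <- bs | idx e.1 == Some p].
have closure_span (D : set J) (P : pred J) u : (forall d, D d -> idx d = Some p /\ P d) ->
    lie_closure br deg y D u -> span [seq e.2 | e <- es & P e.1] u.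
  move=> DP; elim => {u} [d u /DP [dp Pd] du||c u v _ Hu _ Hv].
  - apply: span_trans (bs_span d u (p_tgt d dp) du) => v /mapP[e].
    rewrite mem_filter => /andP[/eqP ed ebs] ->; apply/mem_span/map_f.
    by rewrite !mem_filter ed Pd dp eqxx ebs.
  - exact: span0.
  - exact: span_linear.
have -> : \sum_(d <- with_squares degree_factor ls | idx d == Some p) lam d =
    \sum_(e <- es) lam e.1.
  by rewrite -bs_deg big_map /es big_filter.
apply: (@trace_on_triangular _ _ _ (0, 0) snd f (gr p) es (fun e => lam e.1)
  (fun e => height e.1)) => //.
- move=> v; split=> [/homogeneous_partE|].
    move=> /(closure_span _ xpredT); rewrite filter_predT; apply.
    by move=> d.
  have es_gr e : e \in es -> gr p e.2.
    rewrite mem_filter => /andP[/eqP ep /bs_in/lie_span_gr].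
    by rewrite /degree_space ep.
  elim: es es_gr v {closure_span} => [|e es IH] es_gr v /=.
    by move=> ->; apply: grading0.
  move=> [k /IH Hv]; rewrite -[v](subrK (k *: e.2)) addrC.
  apply: grading_linear; first by apply: es_gr; rewrite inE eqxx.
  by apply: Hv => e' e'es; apply: es_gr; rewrite inE e'es orbT.
- have linF' : linear (fun u => val (F u) : free_alg K X).
    by move=> c u v; rewrite homF.1.
  apply: (@indep_map _ _ _ (fun u => val (F u) : free_alg K X)) => //.
  rewrite -map_comp; apply: (indep_subseq (t := [seq val (F e.2) : free_alg K X | e <- bs])).
    by apply/map_subseq/filter_subseq.
  apply: (bs_indep X (fun u => val (F u) : free_alg K X)) => //.
    by move=> d e u v; apply: (hom_commutator (@idxD I K) idx_deg homF F_letter).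
  by move=> q; apply: (hom_eval_inj F_letter).
- move=> e; rewrite mem_filter => /andP[/eqP ep ebs].
  apply: (closure_span _ (fun d => height d < height e.1)%N) (ftri _ _ (bs_in _ ebs)).
  by move=> d [de he]; rewrite de.
Qed.

End TraceFormula.

Arguments degree_factor {K A} theta {Gam} d e.

(** * The color Lie superalgebra generated by the letters *)

Section GeneratedSubalgebra.
Variables (K : fieldType) (A : zmodType) (theta : A -> A -> K).
Variables (Gam : addSemigroupType).
Notation I := (Gam * A)%type.
Variables (S : lmodType K) (gr : I -> set S) (br : S -> S -> S).
Hypothesis Hcolor : color_lie_superalgebra theta gr br.
Variables (X : choiceType) (ix : X -> I) (deg : X -> degree I K) (y : X -> S).
Hypotheses (idx_deg : forall x, idx (deg x) = Some (ix x))
  (y_gr : forall x, gr (ix x) (y x)).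

Notation part := (homogeneous_part br deg y).

Definition generated_alg := hsum_alg part.
HB.instance Definition _ := GRing.Lmodule.on generated_alg.

Definition generated_gr : I -> set generated_alg := hsum_gr' (gr:=part).

Definition generated_br : generated_alg -> generated_alg -> generated_alg :=
  hsum_bracket (color_linearl Hcolor) (color_linearr Hcolor)
    (homogeneous_part_br Hcolor (deg:=deg) (y:=y)).

Lemma generated_algP : color_lie_superalgebra theta generated_gr generated_br.
Proof.
have sub := homogeneous_part_sub Hcolor idx_deg y_gr.
apply: hsum_color.
- exact: homogeneous_part_closed.
- move=> s w us ws; apply: (grading_free (color_grading Hcolor) us) => p.
  exact/sub/ws.
- by move=> [al a] [be b] u v /sub pu /sub qv; apply: (color_antisym Hcolor pu qv).
- move=> [al a] [be b] r u v w /sub pu /sub qv _.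
  exact: (color_jacobi Hcolor _ pu qv).
Qed.

Lemma generated_val (u : generated_alg) : lie_closure br deg y setT (val u).
Proof.
elim: (hsum_valP u) => {u} [p u pu||c u v _ Hu _ Hv].
- by apply: sub_lie_closure pu.
- exact: lie_closure0.
- exact: lie_closure_linear.
Qed.

End GeneratedSubalgebra.

(** Finitely many index sequences have sum [p], and each index carries finitely many letters. *)
Lemma finitely_many_words (I : addSemigroupType) (X : choiceType) (ix : X -> I)
    (p : I) :
  finitely_many_sums I -> (forall q, exists s : seq X, forall x, ix x = q -> x \in s) ->
  exists ws : seq (word X), forall w : word X,
    \sum_(x <- w) (Some (ix x) : adjoin0 I) = Some p -> w \in ws.
Proof.
move=> /(_ p)/finite_seqP[ss ssE] /choice[L LP].
pose fix over (qs : seq I) : seq (word X) :=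
  if qs is q :: qs' then [seq x :: w | x <- L q, w <- over qs'] else [:: [::]].
have overP (w : word X) : w \in over (map ix w).
  elim: w => [|x w IH] /=; first by rewrite inE.
  by apply/allpairsP; exists (x, w); split => //; apply: LP.
exists (flatten [seq over (s.1 :: s.2) | s <- ss]) => -[|x w] wp.
  by move: wp; rewrite big_nil.
apply/flattenP; exists (over (map ix (x :: w))); last exact: overP.
(* The first letter takes the place of the last term in the encoding of sums; commutativity makes
   the totals agree. *)
apply/mapP; exists (ix x, map ix w) => //.
suff : [set s | sum_nonempty s = p] (ix x, map ix w) by rewrite ssE.
have sumE : Some (foldr (fun a b => a + b) (ix x) (map ix w)) =
    \sum_(z <- x :: w) (Some (ix z) : adjoin0 I).
  rewrite big_cons; elim: w {wp} => [|z w IH] /=; first by rewrite big_nil addr0.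
  by rewrite big_cons addrCA -IH.
by apply: Some_inj; rewrite -wp -sumE.
Qed.

(** * Traces from the universal property *)

Section FreeTrace.
Variables (K : numClosedFieldType) (A : zmodType) (Gam : addSemigroupType).
Notation I := (Gam * A)%type.
Variables (V : lmodType K) (grV : I -> set V).

(* Common consequence of the two universal properties: the last clause says that
   the induced map F is a section of every homomorphism G back to S. *)
Definition free_on (theta : A -> A -> K) (S : lmodType K) (gr : I -> set S)
    (br : S -> S -> S) (iota : V -> S) : Prop :=
  forall (M : lmodType K) (grM : I -> set M) (brM : M -> M -> M) (f : V -> M),
    color_lie_superalgebra theta grM brM -> linear f ->
    degree_preserving grV grM f ->
    exists F : S -> M, [/\ bracket_hom br brM F, forall v, F (iota v) = f v
      & forall G : M -> S, bracket_hom brM br G -> degree_preserving grM gr G ->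
          (forall v, G (f v) = iota v) -> forall u, G (F u) = u].

Hypotheses (HV : grading grV) (Vfin : forall p, finite_dim (grV p)).
Hypothesis Hsums : finitely_many_sums I.
Variable g : V -> V.
Hypotheses (ling : linear g) (grg : degree_preserving grV grV g).

Let two : 2 != 0 :> K. Proof. by rewrite Num.Theory.pnatr_eq0. Qed.
Let three : 3 != 0 :> K. Proof. by rewrite Num.Theory.pnatr_eq0. Qed.

(** The order of quantifiers is the point: [ls] precedes [theta] and [S]. The halves [q] of [p] are
    included because the squares in degree [p] come from elements of these degrees. *)
Lemma free_trace (p : I) : exists ls : seq (degree I K),
  forall (theta : A -> A -> K) (S : lmodType K) (gr : I -> set S)
    (br : S -> S -> S) (iota : V -> S) (f : S -> S),
  coloring_map theta -> color_lie_superalgebra theta gr br -> linear iota ->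
  degree_preserving grV gr iota -> free_on theta gr br iota ->
  bracket_hom br br f -> (forall v, f (iota v) = iota (g v)) ->
  forall q, q = p \/ q + q = p ->
    trace_on f (gr q) = \sum_(d <- with_squares (degree_factor theta) ls
      | idx d == Some q) eig d /\
    trace_on (fun u => f (f u)) (gr q) =
      \sum_(d <- with_squares (degree_factor theta) ls
        | idx d == Some q) eig d ^+ 2.
Proof.
have [X [ix [lam [ht [e [X_fin e_gr e_tri e_span e_free]]]]]] :=
  graded_triangular_basis HV Vfin ling grg.
pose deg x : degree I K := (Some (ix x) : adjoin0 I, lam x : mult_monoid K, ht x).
pose tgt : set (degree I K) :=
  [set d | exists q, idx d = Some q /\ (q = p \/ q + q = p)].
have e_spanT v : exists s, v = comb e s.
  have [s [w [ws ->]]] := grading_span HV v.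
  elim: s => [|q s [t IH]]; first by exists [::]; rewrite big_nil /comb big_nil.
  have [t' [wq _]] := e_span _ _ (ws q).
  by exists (t' ++ t); rewrite big_cons IH wq /comb big_cat.
have idx_degw (w : word X) : idx (degw deg w) = \sum_(x <- w) (Some (ix x) : adjoin0 I).
  by rewrite /degw; elim/big_rec2: _ => // x a b _ <-.
have [ws wsP] := finitely_many_words p Hsums X_fin.
(* If [w] has degree [q] with q + q = p, then [w ++ w] is among the words of degree [p], and [w] is
   its first half. *)
have words_tgt w : tgt (degw deg w) ->
    w \in ws ++ [seq take (size u)./2 u | u <- ws].
  case=> q []; rewrite idx_degw mem_cat => wq [qp|qp].
    by rewrite wsP // wq qp.
  have /wsP ww : \sum_(x <- w ++ w) (Some (ix x) : adjoin0 I) = Some p.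
    by rewrite big_cat /= wq -qp.
  apply/orP; right; apply/mapP; exists (w ++ w) => //.
  by rewrite size_cat addnn doubleK take_size_cat.
have tgt0 : ~ tgt 0 by case=> q [].
have [ls lsP] := lie_basis_exists two three tgt0 words_tgt.
exists ls => theta S gr br iota f Htheta Hcolor lini gri Sfree homf f_iota q qp.
pose y x := iota (e x).
have idx_deg x : idx (deg x) = Some (ix x) by [].
have y_gr x : gr (ix x) (y x) by apply/gri/e_gr.
have iota0 : iota 0 = 0.
  by have := lini (-1) 0 0; rewrite scaler0 addr0 scaleN1r addNr.
have iota_comb s : iota (comb e s) = comb y s.
  rewrite /comb; elim: s => [|t s IH]; first by rewrite !big_nil.
  by rewrite !big_cons lini IH.
have comb_closure (D : set (degree I K)) s : (forall t, t \in s -> D (deg t.2)) ->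
    lie_closure br deg y D (comb y s).
  rewrite /comb; elim: s => [|t s IH] Ds; first by rewrite big_nil; apply: lie_closure0.
  rewrite big_cons; apply: lie_closure_linear.
    by apply: lie_closure_span (lie_span_gen _ _ _ _); apply: Ds; rewrite inE eqxx.
  by apply: IH => t' t's; apply: Ds; rewrite inE t's orbT.
have part_iota q' v : grV q' v -> homogeneous_part br deg y q' (iota v).
  move=> /e_span[s [-> sq]]; rewrite iota_comb; apply: comb_closure => t /sq /= <-.
  exact: idx_deg.
have hsum_iota v : hsum (homogeneous_part br deg y) (iota v).
  have [s ->] := e_spanT v; rewrite iota_comb.
  apply: (lie_closure_hsum Hcolor idx_deg y_gr (D := setT)).
  exact: comb_closure.
(* [F] maps [S] to the generated subalgebra and the inclusion maps back; their composite is the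
   identity, so every element lies in that subalgebra. *)
have generated u : lie_closure br deg y setT u.
  have lin_in : linear (fun v => hsum_in (hsum_iota v) : generated_alg br deg y).
    by move=> c v v'; apply: val_inj => /=; rewrite lini.
  have [F [_ _ /(_ (fun x => val x)) FK]] :=
    Sfree _ _ _ _ (generated_algP Hcolor idx_deg y_gr) lin_in part_iota.
  rewrite -[u]FK //; first exact: generated_val.
  move=> q' x; exact: (homogeneous_part_sub Hcolor idx_deg y_gr).
have [m [linm m_e]] := linear_extension (free_color_letter K ix) e_free e_spanT.
have m_gr : degree_preserving grV (free_color_gr (ix:=ix)) m.
  move=> q' v /e_span[s [-> sq]].
  have m0 : m 0 = 0.
    by have := linm (-1) 0 0; rewrite scaler0 addr0 scaleN1r addNr.
  elim: s sq => [|t s IH] sq.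
    rewrite /comb big_nil m0; exact: (grading0 (free_color_algP Htheta ix)).
  rewrite /comb big_cons linm; apply: (grading_linear (free_color_algP Htheta ix)).
    rewrite m_e -(sq t (mem_head _ _)); exact: homog_letter.
  by apply: IH => t' t's; apply: sq; rewrite inE t's orbT.
have [F [homF F_iota _]] := Sfree _ _ _ _ (free_color_algP Htheta ix) linm m_gr.
have F_letter x : F (y x) = free_color_letter K ix x by rewrite /y F_iota m_e.
have [bs Hbs] := lsP _ _ _ _ _ (@degree_factor_bicharacter _ _ _ Htheta Gam)
  (degree_space_color_bracket Hcolor) (letters_degree_space idx_deg y_gr).
have q_tgt d : idx d = Some q -> tgt d by move=> dq; exists q.
have trace := trace_on_degree Hcolor idx_deg y_gr generated Hbs homF F_letter q_tgt.
have brl := color_linearl Hcolor; have brr := color_linearr Hcolor.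
have ftri : triangular br deg y f (@eig I K).
  apply: triangular_automorphism => //; [exact: homf.1|exact: homf.2|].
  move=> x; have [s [fE slow]] := e_tri x.
  have -> : f (y x) - eig (deg x) *: y x = comb y s.
    rewrite /y f_iota -iota_comb -fE addrC -scaleNr -lini scaleNr addrC.
    by congr (iota _); rewrite addrC.
  by apply: comb_closure => t /slow[it ht_t]; split; [rewrite !idx_deg it|].
split; first by apply: trace => //; exact: homf.1.
apply: trace; last exact: triangular_square homf.1 ftri.
by move=> c u v; rewrite !homf.1.
Qed.

End FreeTrace.

(** * The trivial coloring and the comparison *)

Definition trivial_coloring (K : fieldType) (A : zmodType) (a b : A) : K := 1.
Arguments trivial_coloring {K A} a b.

Section TrivialColoring.
Variables (K : fieldType) (A : zmodType) (Gam : addSemigroupType).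
Hypothesis two : 2 != 0 :> K.
Notation I := (Gam * A)%type.

Lemma trivial_coloringP : coloring_map (@trivial_coloring K A).
Proof. by split=> *; rewrite /trivial_coloring ?mulr1 ?oner_eq0. Qed.

Lemma lie_color_trivial (L : lmodType K) (gr : I -> set L) (br : L -> L -> L) :
  lie_bracket br -> grading gr -> graded_bracket gr br ->
  color_lie_superalgebra trivial_coloring gr br.
Proof.
move=> [brl brr alt jac] Hgr grbr; split=> //.
  move=> al a be b x y _ _; rewrite scale1r; apply/eqP; rewrite -addr_eq0.
  have := alt (x + y); have /= := brl (x + y) 1 x y; rewrite !scale1r => ->.
  have := brr x 1 x y; have := brr y 1 x y; rewrite !scale1r => -> ->.
  by rewrite !alt add0r addr0 => ->.
by move=> al a be b x y z _ _; rewrite scale1r.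
Qed.

(** The ungraded universal property tests against Lie algebras, so the axioms known on homogeneous
    elements are extended to sums; alternation follows from antisymmetry by dividing by 2. *)
Lemma color_trivial_lie (L : lmodType K) (gr : I -> set L) (br : L -> L -> L) :
  color_lie_superalgebra trivial_coloring gr br -> lie_bracket br.
Proof.
move=> Hc; have brl := color_linearl Hc; have brr := color_linearr Hc.
have Hgr := color_grading Hc.
have br0l v : br 0 v = 0 by apply: (linear_at0 (brl v)).
have br0r v : br v 0 = 0 by apply: (linear_at0 (brr v)).
have brDl u v w : br (u + v) w = br u w + br v w.
  by have /= := brl w 1 u v; rewrite !scale1r.
have brDr u v w : br w (u + v) = br w u + br w v.
  by have := brr w 1 u v; rewrite !scale1r.
have anti u v : br u v = - br v u.
  have [s [w [ws ->]]] := grading_span Hgr u.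
  elim: s => [|[al a] s IH]; first by rewrite big_nil br0l br0r oppr0.
  rewrite big_cons brDl brDr opprD IH; congr (_ + _).
  have [t [w' [w's ->]]] := grading_span Hgr v.
  elim: t => [|[be b] t IHt]; first by rewrite big_nil br0l br0r oppr0.
  rewrite big_cons brDl brDr opprD IHt; congr (_ + _).
  by rewrite (color_antisym Hc (ws (al, a)) (w's (be, b))) scale1r.
have jac_hom p x y z : gr p x -> br x (br y z) = br (br x y) z + br y (br x z).
  case: p => al a px; have [t [w' [w's ->]]] := grading_span Hgr y.
  elim: t => [|[be b] t IHt]; first by rewrite big_nil !(br0l, br0r) addr0.
  rewrite big_cons !(brDl, brDr) IHt (color_jacobi Hc _ px (w's (be, b))) scale1r.
  by rewrite addrACA.
split=> // [x|x y z].
  apply/eqP; have := anti x x => /eqP; rewrite -addr_eq0 -mulr2n -scaler_nat.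
  by rewrite scaler_eq0 (negPf two).
have [s [w [ws ->]]] := grading_span Hgr x.
elim: s => [|p s IH]; first by rewrite big_nil !(br0l, br0r) addr0.
by rewrite big_cons !(brDl, brDr) IH (jac_hom _ _ _ _ (ws p)) addrACA.
Qed.

End TrivialColoring.

Section FreeOn.
Variables (K : numClosedFieldType) (A : zmodType) (Gam : addSemigroupType).
Notation I := (Gam * A)%type.
Variables (V : lmodType K) (grV : I -> set V).

Lemma bracket_hom_comp (L M N : lmodType K) (brL : L -> L -> L)
    (brM : M -> M -> M) (brN : N -> N -> N) (F : L -> M) (G : M -> N) :
  bracket_hom brL brM F -> bracket_hom brM brN G ->
  bracket_hom brL brN (fun u => G (F u)).
Proof.
move=> [linF Fbr] [linG Gbr]; split=> [c u v|u v]; first by rewrite linF linG.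
by rewrite Fbr Gbr.
Qed.

Lemma bracket_hom_id (L : lmodType K) (brL : L -> L -> L) : bracket_hom brL brL id.
Proof. by []. Qed.

(** Uniqueness of the endomorphism extending [iota] identifies the composite of [F] and [G] with the
    identity. *)
Lemma free_color_lie_free_on (theta : A -> A -> K) (S : lmodType K)
    (grS : I -> set S) (brS : S -> S -> S) (iota : V -> S) :
  free_color_lie theta grV grS brS iota -> free_on grV theta grS brS iota.
Proof.
move=> [HcS lini gri univ] M grM brM f HcM linf grf.
have [F [[homF grF F_iota] _]] := univ M grM brM f HcM linf grf.
exists F; split=> // G homG grG G_f u.
have [F0 [_ F0_uniq]] := univ S grS brS iota HcS lini gri.
have E1 : F0 = id by apply: F0_uniq; split=> //; exact: bracket_hom_id.
have E2 : F0 = fun u => G (F u).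
  apply: F0_uniq; split; first exact: bracket_hom_comp homF homG.
    by move=> p x /grF/grG.
  by move=> v; rewrite F_iota G_f.
by rewrite -[LHS]/((fun u => G (F u)) u) -E2 E1.
Qed.

Lemma free_lie_free_on (L : lmodType K) (grL : I -> set L) (brL : L -> L -> L)
    (iota : V -> L) :
  free_lie brL iota -> free_on grV trivial_coloring grL brL iota.
Proof.
move=> [HL lini univ] M grM brM f HcM linf _.
have two : 2 != 0 :> K by rewrite Num.Theory.pnatr_eq0.
have [F [[homF F_iota] _]] := univ M brM f (color_trivial_lie two HcM) linf.
exists F; split=> // G homG _ G_f u.
have [F0 [_ F0_uniq]] := univ L brL iota HL lini.
have E1 : F0 = id by apply: F0_uniq; split=> //; exact: bracket_hom_id.
have E2 : F0 = fun u => G (F u).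
  apply: F0_uniq; split; first exact: bracket_hom_comp homF homG.
  by move=> v; rewrite F_iota G_f.
by rewrite -[LHS]/((fun u => G (F u)) u) -E2 E1.
Qed.

End FreeOn.

(** * Eigenvalue sums over lists with squares *)

Section SumWithSquares.
Variables (K : numClosedFieldType) (A : zmodType) (theta : A -> A -> K).
Hypothesis Htheta : coloring_map theta.
Variables (Gam : addSemigroupType).
Notation I := (Gam * A)%type.
Implicit Types ls : seq (degree I K).

Lemma with_squares_trivial ls :
  with_squares (degree_factor trivial_coloring) ls = ls.
Proof.
have neq : (1 == -1 :> K) = false.
  by rewrite -addr_eq0 -mulr2n Num.Theory.pnatr_eq0.
elim: ls => [//|d ls IH].
have -> : with_squares (degree_factor trivial_coloring) (d :: ls) =
    (if 1 == -1 :> K then [:: d; d + d] else [:: d]) ++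
    with_squares (degree_factor trivial_coloring) ls by [].
by rewrite IH neq.
Qed.

Lemma sum_with_squares ls (p : I) :
  \sum_(d <- with_squares (degree_factor theta) ls | idx d == Some p) eig d =
  \sum_(d <- ls | idx d == Some p) eig d +
  \sum_(d <- ls | (degree_factor theta d d == -1) && (idx (d + d) == Some p))
    eig d ^+ 2.
Proof.
elim: ls => [|d ls IH]; first by rewrite !big_nil addr0.
rewrite /with_squares /= big_cat /= -/(with_squares _ _) IH !big_cons.
case: (degree_factor theta d d == -1) => /=; rewrite !big_cons big_nil.
  case: (idx d == Some p); case: (idx (d + d) == Some p);
    rewrite ?addr0 ?add0r ?eigD -?expr2 //.
  - exact: addrACA.
  - exact: addrA.
  - exact: addrCA.
by case: (idx d == Some p); rewrite ?addr0 ?add0r ?addrA.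
Qed.

(** A half of [p] is a two-term sum with total [p]. The explicit list turns the sum over a set into
    an ordinary finite sum. *)
Lemma finite_halves (p : I) : finitely_many_sums I ->
  exists2 r : seq I, uniq r &
    [set q : I | odd_elements theta q.2 /\ q + q = p] = [set` r].
Proof.
move=> /(_ p)/finite_seqP[ss ssE].
exists (undup [seq q <- [seq s.1 | s <- ss] |
  `[< odd_elements theta q.2 /\ q + q = p >]]); first exact: undup_uniq.
rewrite eqEsubset; split=> q /=; rewrite mem_undup mem_filter.
  move=> Hq; apply/andP; split; first exact/asboolP.
  apply/mapP; exists (q, [:: q]) => //.
  suff : [set s | sum_nonempty s = p] (q, [:: q]) by rewrite ssE.
  by case: Hq.
by move=> /andP[/asboolP].
Qed.

(** After exchanging the sums, each [d] is counted at most once, for [q] equal to its own index. *)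
Lemma sum_odd_halves ls (p : I) : finitely_many_sums I ->
  \sum_(q \in [set q : I | odd_elements theta q.2 /\ q + q = p])
    \sum_(d <- ls | idx d == Some q) eig d ^+ 2 =
  \sum_(d <- ls | (degree_factor theta d d == -1) && (idx (d + d) == Some p))
    eig d ^+ 2.
Proof.
move=> Hsums; have [r ur rE] := finite_halves p Hsums.
rewrite rE -fsbig_seq // (exchange_big_dep xpredT) //= [RHS]big_mkcond.
apply: eq_bigr => d _; rewrite idxD /degree_factor.
have mem_r q : (q \in r) = (theta q.2 q.2 == -1) && (q + q == p).
  have : [set` r] q <-> odd_elements theta q.2 /\ q + q = p by rewrite -rE.
  rewrite /odd_elements /psi /= => H; apply/idP/andP => [/H[-> ->]|[/eqP a /eqP b]].
    by rewrite !eqxx.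
  exact/H.
case: (idx d) => [q|]; last by rewrite andbF big_pred0.
have -> : ((Some q : adjoin0 I) + Some q == Some p) = (q + q == p) by [].
rewrite /= -mem_r; case: ifP => qr.
  by rewrite (big_rem q) //= eqxx big1_seq ?addr0 // => q' /andP[/eqP[<-]];
    rewrite mem_rem_uniq // inE eqxx.
by rewrite big1_seq // => q' /andP[/eqP[<-]]; rewrite qr.
Qed.

(** By bimultiplicativity psi(2b) = psi(b)^4. *)
Lemma psi_double (b : A) : psi theta b = -1 -> psi theta (b + b) = 1.
Proof.
by rewrite /psi => b1; rewrite (coloringDl Htheta) !(coloringDr Htheta) b1; ring.
Qed.

End SumWithSquares.

Theorem proposition4p2 (R : realType)
  (A : zmodType) (hA : countable [set: A])
  (theta : A -> A -> R[i]) (htheta : coloring_map theta)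
  (Gam : addSemigroupType) (hGam : countable [set: Gam])
  (hsum : finitely_many_sums (Gam * A)%type)
  (V : lmodType R[i]) (grV : Gam * A -> set V)
  (hV : grading grV) (hVfin : forall p, finite_dim (grV p))
  (L : lmodType R[i]) (brL : L -> L -> L) (iotaL : V -> L)
  (hL : free_lie brL iotaL)
  (grL : Gam * A -> set L) (hgrL : induced_grading grV brL iotaL grL)
  (S : lmodType R[i]) (grS : Gam * A -> set S) (brS : S -> S -> S)
  (iotaS : V -> S) (hS : free_color_lie theta grV grS brS iotaS)
  (G : groupType)
  (rho : G -> V -> V) (hrho : linear_action rho)
  (hrho_gr : forall g, degree_preserving grV grV (rho g))
  (rhoL : G -> L -> L) (hrhoL : linear_action rhoL)
  (hrhoL_aut : forall g, bracket_hom brL brL (rhoL g))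
  (hrhoL_ext : extends_action iotaL rho rhoL)
  (rhoS : G -> S -> S) (hrhoS : linear_action rhoS)
  (hrhoS_aut : forall g, bracket_hom brS brS (rhoS g) /\
                         degree_preserving grS grS (rhoS g))
  (hrhoS_ext : extends_action iotaS rho rhoS)
  (g : G) (al : Gam) (a : A) :
  supertrace_on theta (rhoS g) grS (al, a) =
    psi theta a * trace_on (rhoL g) (grL (al, a)) +
    \sum_(q \in [set q : Gam * A |
                  odd_elements theta q.2 /\ q + q = (al, a)])
      trace_on (rhoL (g ^+ 2)%g) (grL q).
Proof.
have hrhog := action_linear hrho g.
have [ls lsP] := free_trace hV hVfin hsum hrhog (hrho_gr g) (al, a).
case: (hgrL) => hgrading hgbr hiota_gr; case: (hL) => hLie hlinL _.
have hLc := lie_color_trivial hLie hgrading hgbr.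
have traceL := lsP _ _ _ _ _ (rhoL g) (trivial_coloringP R[i] A) hLc hlinL hiota_gr
  (free_lie_free_on grL hL) (hrhoL_aut g) (hrhoL_ext g).
case: (hS) => hSc hlinS hgrS _.
have [traceS _] := lsP _ _ _ _ _ (rhoS g) htheta hSc hlinS hgrS
  (free_color_lie_free_on hS) (hrhoS_aut g).1 (hrhoS_ext g) (al, a) (or_introl erefl).
rewrite /supertrace_on traceS sum_with_squares mulrDr /=.
have [-> _] := traceL (al, a) (or_introl erefl); rewrite with_squares_trivial.
congr (_ + _).
have -> : rhoL (g ^+ 2)%g = (fun u => rhoL g (rhoL g u)).
  by apply/funext => u; rewrite -(actionM hrhoL).
rewrite -(sum_odd_halves theta ls (al, a) hsum).
have [r ur rE] := finite_halves theta (al, a) hsum.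
rewrite rE -!fsbig_seq // mulr_sumr big_seq [RHS]big_seq; apply: eq_bigr => q qr.
have [q_odd qq] : [set q : Gam * A | odd_elements theta q.2 /\ q + q = (al, a)] q.
  by rewrite rE.
(* The sign in the supertrace also multiplies the contribution of the squares. It is 1 whenever that
   sum has a term, since then [a] is twice an odd element. *)
have -> : psi theta a = 1.
  by rewrite -[a]/((al, a).2) -qq /=; apply: psi_double.
by have [_ ->] := traceL q (or_intror qq); rewrite with_squares_trivial mul1r.
Qed.
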